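(* Let $(R,\mathfrak{m})$ be a regular local ring of dimension $n$, let $I$ be an ideal of $R$ generated by an $R$-regular sequence of length $k\leq n$, and let $J$ be an ideal of $R$ generated by an $R$-regular sequence of length $n$, such that $I+J$ is $\mathfrak{m}$-primary. Assume that at least one of the following holds: (i) either $I\subseteq J$ or $J\subseteq I$; (ii) $k=2$; (iii) $1\leq k\leq n-1$, and $J=(f_1,\ldots,f_n)$ where $f_1,\ldots,f_n$ is an $R$-regular sequence such that $(f_1,\ldots,f_k)\subseteq I$ and $f_{k+1},\ldots,f_n$ is an $(R/I)$-regular sequence; (iv) $n\geq 4$, $3\leq k\leq n-1$, and $J=(f_1,\ldots,f_n)$ where $f_1,\ldots,f_n$ is an $R$-regular sequence such that $(f_1,\ldots,f_{k-1})\subseteq I$ and $f_{k+1},\ldots,f_n$ is an $(R/I)$-regular sequence. Then, for every $0\leq i\leq k$, \[ \ell\left(\operatorname{Tor}_i^R(R/I,R/J)\right)=\binom{k}{i}\,\ell\left(\frac{R}{I+J}\right). \]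
   Context: All rings are commutative with unity, and a local ring is a commutative Noetherian ring with a unique maximal ideal. $\ell$ denotes the length function in the category of $R$-modules. *)

(* Defs.v *)
From HB Require Import structures.
From mathcomp Require Import all_boot all_order all_algebra.
From mathcomp Require Import generic_quotient ring_quotient.
From mathcomp Require Import boolp classical_sets constructive_ereal.
From mathcomp Require Import freeg.

Set Implicit Arguments.
Unset Strict Implicit.
Unset Printing Implicit Defensive.

Import Order.TTheory GRing.Theory Num.Theory.
Local Open Scope ring_scope.
Local Open Scope quotient_scope.

(* Submodules of V are the predicates [N : submodClosed V] of MathComp; they
   are compared extensionally, with [=i] and [{subset _ <= _}], because the
   record also carries closure proofs. *)

Section Submodules.
Variables (R : comNzRingType) (V : lmodType R).

Definition span (X : set V) : {pred V} :=
  fun v => `[< exists2 s : seq (R * V),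
    (forall p, p \in s -> X p.2) & v = \sum_(p <- s) p.1 *: p.2 >].

Lemma span_submod_closed X : submod_closed (span X).
Proof.
split; first by apply/asboolP; exists [::] => //; rewrite big_nil.
move=> a u v /asboolP[s sX ->] /asboolP[t tX ->]; apply/asboolP.
exists ([seq (a * p.1, p.2) | p <- s] ++ t).
  by move=> p; rewrite mem_cat => /orP[/mapP[q qs ->]|/tX//]; exact: sX qs.
rewrite big_cat big_map scaler_sumr /=; congr (_ + _).
by apply: eq_bigr => p _; rewrite scalerA.
Qed.
HB.instance Definition _ X :=
  GRing.isSubmodClosed.Build R V (span X) (span_submod_closed X).

Definition addsm (M N : submodClosed V) : {pred V} :=
  fun v => `[< exists a b, [/\ a \in M, b \in N & v = a + b] >].

Lemma addsm_submod_closed M N : submod_closed (addsm M N).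
Proof.
split.
  by apply/asboolP; exists 0, 0; split; rewrite ?rpred0 ?addr0.
move=> c u v /asboolP[a [b [aM bN ->]]] /asboolP[a' [b' [aM' bN' ->]]].
apply/asboolP; exists (c *: a + a'), (c *: b + b').
by split; rewrite ?rpredD ?rpredZ// scalerDr addrACA.
Qed.
HB.instance Definition _ M N :=
  GRing.isSubmodClosed.Build R V (addsm M N) (addsm_submod_closed M N).

(* The supremum, in {0, 1, 2, ..., +oo}, of the r such that there is a strict
   chain N_0 < N_1 < ... < N_r of submodules of V satisfying P.  (It is only
   meaningful when some submodule satisfies P, as is the case below.) *)
Definition has_chain (P : submodClosed V -> Prop) (r : nat) : Prop :=
  exists N : nat -> submodClosed V,
    (forall i, (i <= r)%N -> P (N i)) /\
    (forall i, (i < r)%N -> {subset N i <= N i.+1} /\ ~ (N i =i N i.+1)).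

Definition chain_height (P : submodClosed V -> Prop) : \bar int :=
  if pselect (exists r, has_chain P r /\ forall t, has_chain P t -> (t <= r)%N)
    is left ex_max then (projT1 (cid ex_max))%:Z%:E else +oo%E.

End Submodules.

Definition mlength (R : comNzRingType) (V : lmodType R) : \bar int :=
  chain_height (fun _ : submodClosed V => True).

Section QuotientModule.
Variables (R : comNzRingType) (V : lmodType R) (N : submodClosed V).

(* A submodClosed predicate is not known to MathComp to be closed under
   opposite, since V could a priori be a semimodule *)
Definition subgroup_of : {pred V} := fun v => v \in N.
Lemma subgroup_of_zmod_closed : zmod_closed subgroup_of.
Proof.
split=> [|u v uN vN]; rewrite unfold_in /subgroup_of ?rpred0//.
by rewrite -scaleN1r rpredD// rpredZ.
Qed.
HB.instance Definition _ :=
  GRing.isZmodClosed.Build V subgroup_of subgroup_of_zmod_closed.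

Definition qmod : Type := Quotient.quot subgroup_of.
HB.instance Definition _ := GRing.Zmodule.on qmod.
HB.instance Definition _ :
  EqQuotient V (Quotient.equiv subgroup_of) qmod := EqQuotient.on qmod.
HB.instance Definition _ :=
  @isZmodQuotient.Build V (Quotient.equiv subgroup_of) 0 -%R +%R qmod
    (@pi_zeror _ _ _ _ _ (Quotient.quot subgroup_of)) (@pi_oppr _ _ _ _ _ (Quotient.quot subgroup_of))
    (@pi_addr _ _ _ _ _ (Quotient.quot subgroup_of)).

Lemma qmod_eqP (u v : V) : reflect (u = v %[mod qmod]) (u - v \in N).
Proof.
by rewrite -[_ \in N]/(u - v \in subgroup_of) Quotient.idealrBE; exact: eqP.
Qed.

Definition qmod_scale (a : R) (x : qmod) : qmod := \pi_qmod (a *: repr x).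

Lemma pi_scale a (v : V) : \pi_qmod (a *: v) = qmod_scale a (\pi_qmod v).
Proof.
apply/qmod_eqP; rewrite -scalerBr rpredZ//.
by apply/qmod_eqP; rewrite reprK.
Qed.

Fact qmod_scaleA a b x : qmod_scale a (qmod_scale b x) = qmod_scale (a * b) x.
Proof.
have [v ->] : exists v, x = \pi_qmod v by exists (repr x); rewrite reprK.
by rewrite -!pi_scale scalerA.
Qed.
Fact qmod_scale1 : left_id 1 qmod_scale.
Proof. by move=> x; rewrite /qmod_scale scale1r reprK. Qed.
Fact qmod_scaleDr : right_distributive qmod_scale +%R.
Proof.
move=> a x y.
have [u ->] : exists v, x = \pi_qmod v by exists (repr x); rewrite reprK.
have [v ->] : exists v, y = \pi_qmod v by exists (repr y); rewrite reprK.
by rewrite -raddfD -!pi_scale -raddfD scalerDr.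
Qed.
Fact qmod_scaleDl x : {morph qmod_scale^~ x : a b / a + b}.
Proof.
move=> a b.
have [v ->] : exists v, x = \pi_qmod v by exists (repr x); rewrite reprK.
by rewrite -!pi_scale -raddfD scalerDl.
Qed.
HB.instance Definition _ := GRing.Zmodule_isLmodule.Build R qmod
  qmod_scaleA qmod_scale1 qmod_scaleDr qmod_scaleDl.


Lemma pi_is_scalable : scalable \pi_qmod.
Proof. exact: pi_scale. Qed.
HB.instance Definition _ :=
  GRing.isScalable.Build R V qmod *:%R \pi_qmod pi_is_scalable.

End QuotientModule.

Notation ideal R := (submodClosed R^o).

Section Ideals.
Variable R : comNzRingType.
Implicit Types (I P Q : ideal R) (s : seq R).

Definition ideal_gen s : ideal R := span [set x : R^o | x \in s].

Definition proper_id I : Prop := (1 : R) \notin I.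

Definition prime_id P : Prop :=
  proper_id P /\ forall x y : R, x * y \in P -> x \in P \/ y \in P.

Definition maximal_id P : Prop :=
  proper_id P /\ forall Q, proper_id Q -> {subset P <= Q} -> P =i Q.

Definition primary_id Q : Prop :=
  proper_id Q /\
  forall x y : R, x * y \in Q -> x \in Q \/ exists t : nat, y ^+ t \in Q.

Definition primary_to P Q : Prop :=
  primary_id Q /\ forall x : R, x \in P <-> exists t : nat, x ^+ t \in Q.

Definition noetherian : Prop := forall I, exists s, I =i ideal_gen s.

Definition local_ring (m : ideal R) : Prop :=
  [/\ noetherian, maximal_id m & forall Q, maximal_id Q -> Q =i m].

Definition krull_dim : \bar int := chain_height prime_id.

Definition regular_local_ring (m : ideal R) : Prop :=
  local_ring m /\
  exists s, (size s)%:Z%:E = krull_dim /\ m =i ideal_gen s.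

(* The submodule (s)M of M *)
Definition seq_mul (M : lmodType R) s : submodClosed M :=
  span [set a *: v | a in [set a | a \in s] & v in [set: M]]%classic.

Definition regular_seq (M : lmodType R) s : Prop :=
  (forall i, (i < size s)%N ->
     forall x : qmod (seq_mul M (take i s)), s`_i *: x = 0 -> x = 0) /\
  (exists x : qmod (seq_mul M s), x <> 0).

Definition gen_by_regular_seq I (k : nat) : Prop :=
  exists s, [/\ size s = k, regular_seq R^o s & I =i ideal_gen s].

End Ideals.

(* Complexes are indexed by nat, and C 0 -> 0 is encoded by the zero map
   C 0 -> C 0. *)

Section Homology.
Variable R : comNzRingType.

Section KerIm.
Variables (A B C : lmodType R) (f : {linear A -> B}) (g : {linear B -> C}).

Definition kerp : {pred B} := fun x => g x == 0.
Lemma kerp_submod_closed : submod_closed kerp.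
Proof.
split=> [|a u v]; rewrite !unfold_in /kerp ?linear0// => /eqP gu /eqP gv.
by rewrite linearP gu gv scaler0 addr0.
Qed.
HB.instance Definition _ :=
  GRing.isSubmodClosed.Build R B kerp kerp_submod_closed.

Record kermod : Type := Kermod { kerval : B; _ : kerval \in kerp }.
HB.instance Definition _ := [isSub for kerval].
HB.instance Definition _ := [Choice of kermod by <:].
HB.instance Definition _ := [SubChoice_isSubLmodule of kermod by <:].

Definition boundary : {pred kermod} :=
  fun x => `[< exists y : A, f y = val x >].
Lemma boundary_submod_closed : submod_closed boundary.
Proof.
split; first by apply/asboolP; exists 0; rewrite !linear0.
move=> a u v /asboolP[y fy] /asboolP[z fz]; apply/asboolP.
by exists (a *: y + z); rewrite !linearP fy fz.
Qed.
HB.instance Definition _ :=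
  GRing.isSubmodClosed.Build R kermod boundary boundary_submod_closed.

Definition homology_at : lmodType R := qmod boundary.
End KerIm.

Definition homology (C : nat -> lmodType R)
    (d : forall i, {linear C i.+1 -> C i}) (i : nat) : lmodType R :=
  match i with
  | 0 => homology_at (d 0) (\0%R : {linear C 0 -> C 0})
  | j.+1 => homology_at (d j.+1) (d j)
  end.

End Homology.

(* {freeg K / R} is the free R-module on the set K; the freeg library only
   records that fglift is additive. *)
Section FreeLift.
Variables (R : comNzRingType) (K : choiceType) (M : lmodType R) (f : K -> M).

Definition free_lift (D : {freeg K / R}) : M := fglift f D.

Lemma free_lift_is_zmod_morphism : zmod_morphism free_lift.
Proof. exact: lift_is_additive. Qed.
HB.instance Definition _ := GRing.isZmodMorphism.Build {freeg K / R} M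
  free_lift free_lift_is_zmod_morphism.

Lemma free_liftU a k : free_lift << a *g k >> = a *: f k.
Proof. exact: liftU. Qed.

Lemma free_lift_is_scalable : scalable free_lift.
Proof.
move=> a D.
have -> : a *: D = \sum_(k <- dom D) << a * coeff k D *g k >> by [].
rewrite -[D in RHS]freeg_sumE !raddf_sum.
by apply: eq_bigr => k _; rewrite /= !free_liftU scalerA.
Qed.
HB.instance Definition _ := GRing.isScalable.Build R {freeg K / R} M *:%R
  free_lift free_lift_is_scalable.

End FreeLift.

Section Tensor.
Variable R : comNzRingType.

Section Def.
Variables M N : lmodType R.
Local Notation F := {freeg (M * N)%type / R}.
Local Notation "<[ m , n ]>" := (<< (m, n) >> : F).

Inductive bilin_rel : F -> Prop :=
| BilinDl (m m' : M) (n : N) :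
    bilin_rel (<[ m + m', n ]> - <[ m, n ]> - <[ m', n ]>)
| BilinDr (m : M) (n n' : N) :
    bilin_rel (<[ m, n + n' ]> - <[ m, n ]> - <[ m, n' ]>)
| BilinZl a (m : M) (n : N) : bilin_rel (<[ a *: m, n ]> - a *: <[ m, n ]>)
| BilinZr a (m : M) (n : N) : bilin_rel (<[ m, a *: n ]> - a *: <[ m, n ]>).

Definition tensor : lmodType R := qmod (span bilin_rel).

Definition tens (m : M) (n : N) : tensor := \pi_(qmod (span bilin_rel)) <[ m, n ]>.

Lemma tensDl m m' n : tens (m + m') n = tens m n + tens m' n.
Proof.
rewrite /tens -raddfD; apply/qmod_eqP; apply/asboolP.
exists [:: (1, <[ m + m', n ]> - <[ m, n ]> - <[ m', n ]>)].
  by move=> p; rewrite inE => /eqP ->; exact: BilinDl.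
by rewrite big_seq1 scale1r opprD addrA.
Qed.

Lemma tensDr m n n' : tens m (n + n') = tens m n + tens m n'.
Proof.
rewrite /tens -raddfD; apply/qmod_eqP; apply/asboolP.
exists [:: (1, <[ m, n + n' ]> - <[ m, n ]> - <[ m, n' ]>)].
  by move=> p; rewrite inE => /eqP ->; exact: BilinDr.
by rewrite big_seq1 scale1r opprD addrA.
Qed.

Lemma tensZl a m n : tens (a *: m) n = a *: tens m n.
Proof.
rewrite /tens -[RHS]pi_scale; apply/qmod_eqP; apply/asboolP.
exists [:: (1, <[ a *: m, n ]> - a *: <[ m, n ]>)].
  by move=> p; rewrite inE => /eqP ->; exact: BilinZl.
by rewrite big_seq1 scale1r.
Qed.

Lemma tensZr a m n : tens m (a *: n) = a *: tens m n.
Proof.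
rewrite /tens -[RHS]pi_scale; apply/qmod_eqP; apply/asboolP.
exists [:: (1, <[ m, a *: n ]> - a *: <[ m, n ]>)].
  by move=> p; rewrite inE => /eqP ->; exact: BilinZr.
by rewrite big_seq1 scale1r.
Qed.

End Def.

Section Map.
Variables (M M' N : lmodType R) (f : {linear M -> M'}).

(* f (x) N, first on the free module, then on the quotient *)
Let pre_tmap : {linear {freeg (M * N)%type / R} -> tensor M' N} :=
  free_lift (fun p : M * N => tens (f p.1) p.2).

Definition tmap (t : tensor M N) : tensor M' N :=
  pre_tmap (repr (t : qmod (span (@bilin_rel M N)))).

Let pre_tmap0 x : x \in span (@bilin_rel M N) -> pre_tmap x = 0.
Proof.
have U m n : pre_tmap << (m, n) >> = tens (f m) n.
  by rewrite [LHS]free_liftU scale1r.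
have V y : bilin_rel y -> pre_tmap y = 0.
  case=> [m m' n|m n n'|a m n|a m n];
    rewrite !linearB ?linearZ_LR /= !U ?linearD ?linearZ_LR /=
            ?(tensDl, tensDr, tensZl, tensZr).
  - by rewrite addrAC addrK subrr.
  - by rewrite addrAC addrK subrr.
  - by rewrite scalerN subrr.
  - by rewrite scalerN subrr.
move=> /asboolP[s sX ->]; rewrite linear_sum big_seq big1// => p /sX Xp.
by rewrite linearZ_LR V// scaler0.
Qed.

Lemma pi_tmap x : tmap (\pi_(qmod (span (@bilin_rel M N))) x) = pre_tmap x.
Proof.
rewrite /tmap; set y := repr _; apply/eqP; rewrite -subr_eq0 -linearB.
by apply/eqP/pre_tmap0/qmod_eqP; rewrite /y reprK.
Qed.

Lemma tmap_tens m n : tmap (tens m n) = tens (f m) n.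
Proof. by rewrite pi_tmap [LHS]free_liftU scale1r. Qed.

Lemma tmap_is_linear : linear tmap.
Proof.
move=> a u v.
have [x ->] : exists x, u = \pi_(qmod (span (@bilin_rel M N))) x.
  by exists (repr (u : qmod (span (@bilin_rel M N)))); rewrite reprK.
have [y ->] : exists x, v = \pi_(qmod (span (@bilin_rel M N))) x.
  by exists (repr (v : qmod (span (@bilin_rel M N)))); rewrite reprK.
rewrite -[X in tmap (X + _)]pi_scale -raddfD !pi_tmap.
exact: linearP.
Qed.
HB.instance Definition _ :=
  GRing.isLinear.Build R (tensor M N) (tensor M' N) *:%R tmap tmap_is_linear.

End Map.
End Tensor.
Arguments tmap {R M M'} N f t.

(* Tor, through the resolution of M whose terms are
     free_res M 0 = free module on the set M,
     free_res M i.+1 = free module on the set syzygy M i.+1,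
   with syzygy M 0 = M and syzygy M i.+1 the kernel of
   free_res M i -> syzygy M i. *)
Section Tor.
Variable R : comNzRingType.

Definition free_on (M : lmodType R) : lmodType R := {freeg M / R}.

Definition aug (M : lmodType R) : {linear free_on M -> M} :=
  free_lift (fun m : M => m).

Definition ker_aug (M : lmodType R) : lmodType R := kermod (aug M).

Definition syzygy (M : lmodType R) (i : nat) : lmodType R := iter i ker_aug M.

Definition free_res (M : lmodType R) (i : nat) : lmodType R :=
  free_on (syzygy M i).

Definition free_res_diff (M : lmodType R) (i : nat) :
    {linear free_res M i.+1 -> free_res M i} :=
  (val : ker_aug (syzygy M i) -> free_res M i) \o aug (syzygy M i.+1).

Lemma aug_surj (M : lmodType R) (m : M) : exists x, aug M x = m.
Proof. by exists << m >>; rewrite [LHS]free_liftU scale1r. Qed.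

Lemma free_res_exact0 (M : lmodType R) (x : free_res M 0) :
  aug M x = 0 <-> exists y, free_res_diff M 0 y = x.
Proof.
split=> [x0|[y <-]].
  have kx : x \in kerp (aug M) by rewrite unfold_in /kerp x0.
  by have [y yE] := aug_surj (Kermod kx : ker_aug M); exists y; rewrite /= yE.
by rewrite /=; case: (free_lift _ y) => z /= /eqP.
Qed.

Lemma free_res_exact (M : lmodType R) (i : nat) (x : free_res M i.+1) :
  free_res_diff M i x = 0 <-> exists y, free_res_diff M i.+1 y = x.
Proof.
split=> [/= x0|[y <-]].
  have ax : aug (syzygy M i.+1) x = 0 by apply: val_inj; rewrite [LHS]x0 raddf0.
  exact/(free_res_exact0 (M := syzygy M i.+1)).
rewrite /= ((free_res_exact0 (M := syzygy M i.+1) _).2) ?linear0//.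
by exists y.
Qed.

Definition Tor (i : nat) (M N : lmodType R) : lmodType R :=
  homology (C := fun j => tensor (free_res M j) N)
    (fun j => tmap N (free_res_diff M j)) i.

End Tor.

(* Main.v *)
From HB Require Import structures.
Require Import Defs.
From mathcomp Require Import all_boot all_order all_algebra.
From mathcomp Require Import constructive_ereal.
From mathcomp Require Import generic_quotient.
From mathcomp Require Import boolp.
From mathcomp Require Import freeg.
From mathcomp Require Import ring zify.

Set Implicit Arguments.
Unset Strict Implicit.
Unset Printing Implicit Defensive.

Import Order.TTheory GRing.Theory Num.Theory.
Local Open Scope ring_scope.
Local Open Scope quotient_scope.

(** Write T_i = Tor_i(R/I,R/J) and compute it from a free resolution P of R/I as
    the homology of P/JP.  If y is regular modulo an ideal a, multiplication by
    y on P/aP yields exact sequences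
      0 -> coker(y | H_i(P/aP)) -> H_i(P/(a,y)P) -> ker(y | H_(i-1)(P/aP)) -> 0.
    When y lies in I it kills H(P/aP), and Pascal's rule appears; when y is
    regular on R/(I+a) and H(P/aP) is concentrated in degree 0, so is
    H(P/(a,y)P).  Regular sequences in R can be reordered, so in case (iii) one
    adjoins f_(k+1),...,f_n first and f_1,...,f_k last; in case (iv) f_k comes
    in between, where it has a kernel and a cokernel of equal finite length.
    Case (i) is the same argument, up to the symmetry of Tor.

    For k = 2 the lengths are e, e + g, g with e, g the lengths of R/(I+J) and
    (J : I)/J, and e = g because R/J has a simple socle.  Indeed, let z be n
    generators of m: the Koszul homology H(z; -) is killed by the regular
    sequence s generating J, so the exact sequences above, for the Koszul
    complex, give H_i(z; R) = 0 for i > 0 and then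
    length H_n(z; R/J) = length R/m = 1. *)
(** * Submodules as predicates, and lengths of subquotients *)

(** Two choices shape the development. All quotients P/aP are studied inside one P, as pairs of
    nested predicates, so that adjoining y to a changes predicates but not modules; and isomorphisms
    of subquotients are linear correspondences, so that a connecting map is just a relation. That y
    in I kills H(P/aP) = Tor(R/I,R/a) is not visible on P, whose terms are free. It is evident when
    the second argument is the one killed by y, and the symmetry of Tor transfers it. Symmetry also
    lets k = 2 start from a resolution of R/J: with I = (x,y), adjoining x produces R/(J+xR) and (J
    : x)/J, and adjoining y brings in its cokernel on the first and its kernel on the second, which
    are R/(I+J) and (J : I)/J. The simple socle uses that z and s have the same length n: H_i(z;
    R/J) is zero for i > n, and since each member of s kills Koszul homology, removing one from the
    ideal lowers this bound by one, down to 0. Then e = g because the colon into J cannot increase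
    lengths when the socle of R/J has length 1. *)

Section Submodule.
Variables (R : comNzRingType) (V : lmodType R).
Implicit Types (P Q U W : V -> Prop).

Definition submodp P := P 0 /\ forall a u v, P u -> P v -> P (a *: u + v).

Definition subp P Q := forall v, P v -> Q v.

Definition ssubp P Q := subp P Q /\ exists2 v, Q v & ~ P v.

Definition sumsm P Q v := exists p q, [/\ P p, Q q & v = p + q].

Definition capsm P Q v := P v /\ Q v.

Definition zerosm : V -> Prop := fun v => v = 0.

Definition allsm : V -> Prop := fun=> True.

Lemma submodp0 P : submodp P -> P 0. Proof. by case. Qed.

Lemma submodpD P u v : submodp P -> P u -> P v -> P (u + v).
Proof. by move=> [_ H] Pu Pv; rewrite -[u]scale1r; exact: H. Qed.

Lemma submodpZ P a u : submodp P -> P u -> P (a *: u).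
Proof. by move=> [P0 H] Pu; rewrite -[_ *: _]addr0; exact: H. Qed.

Lemma submodpN P u : submodp P -> P u -> P (- u).
Proof. by move=> sP Pu; rewrite -scaleN1r; exact: submodpZ. Qed.

Lemma submodpB P u v : submodp P -> P u -> P v -> P (u - v).
Proof. by move=> sP Pu Pv; apply: submodpD => //; exact: submodpN. Qed.

Lemma submodp_sum P I (r : seq I) (F : I -> V) :
  submodp P -> (forall i, P (F i)) -> P (\sum_(i <- r) F i).
Proof.
move=> sP PF; elim: r => [|i r IH]; first by rewrite big_nil; case: sP.
by rewrite big_cons; exact: submodpD.
Qed.

Lemma submodp_sum_seq P (I : eqType) (r : seq I) (F : I -> V) :
  submodp P -> (forall i, i \in r -> P (F i)) -> P (\sum_(i <- r) F i).
Proof.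
move=> sP; elim: r => [|i r IH] PF; first by rewrite big_nil; case: sP.
rewrite big_cons; apply: submodpD => //; first exact/PF/mem_head.
by apply: IH => j jr; apply: PF; rewrite in_cons jr orbT.
Qed.

Lemma submodp_mem (N : submodClosed V) : submodp (fun v => v \in N).
Proof. by split=> [|a u v uN vN]; rewrite ?rpred0// rpredD// rpredZ. Qed.

Lemma in_span P v : submodp P -> (v \in Defs.span P) <-> P v.
Proof.
move=> sP; split=> [/asboolP[s sX ->]|Pv].
  by apply: submodp_sum_seq => // p /sX; exact: submodpZ.
apply/asboolP; exists [:: (1, v)]; last by rewrite big_seq1 scale1r.
by move=> p; rewrite inE => /eqP ->.
Qed.

Lemma submodp_zero : submodp zerosm.
Proof. by split=> // a u v -> ->; rewrite scaler0 addr0. Qed.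

Lemma submodp_all : submodp allsm. Proof. by []. Qed.

Lemma submodp_sumsm P Q : submodp P -> submodp Q -> submodp (sumsm P Q).
Proof.
move=> sP sQ; split; first by exists 0, 0; rewrite addr0; split=> //; case: sP; case: sQ.
move=> a _ _ [p [q [Pp Qq ->]]] [p' [q' [Pp' Qq' ->]]].
exists (a *: p + p'), (a *: q + q'); split; [by apply sP|by apply sQ|].
by rewrite scalerDr addrACA.
Qed.

Lemma submodp_cap P Q : submodp P -> submodp Q -> submodp (capsm P Q).
Proof.
move=> [P0 sP] [Q0 sQ]; split=> // a u v [Pu Qu] [Pv Qv].
by split; [exact: sP|exact: sQ].
Qed.

Lemma subp_suml P Q : submodp Q -> subp P (sumsm P Q).
Proof. by move=> [Q0 _] v Pv; exists v, 0; rewrite addr0. Qed.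

Lemma subp_sumr P Q : submodp P -> subp Q (sumsm P Q).
Proof. by move=> [P0 _] v Qv; exists 0, v; rewrite add0r. Qed.

Lemma sumsm_sub P Q W : submodp W -> subp P W -> subp Q W -> subp (sumsm P Q) W.
Proof. by move=> sW PW QW _ [p [q [/PW Wp /QW Wq ->]]]; exact: submodpD. Qed.

(* A strict chain of r + 1 submodules with top member U; P is a lower bound of
   the chain, not necessarily a member. *)
Fixpoint hc r P U : Prop :=
  if r is r'.+1 then exists W, [/\ submodp W, hc r' P W & ssubp W U]
  else subp P U.

Lemma hc_sub r P U : hc r P U -> subp P U.
Proof.
elim: r U => [//|r IH] U /= [W [_ /IH PW [WU _]]] v /PW; exact: WU.
Qed.

Lemma hc_monor r P U U' : subp U U' -> hc r P U -> hc r P U'.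
Proof.
move=> UU'; case: r => [PU v /PU|r /= [W [sW h [WU [v Uv nWv]]]]]; first exact: UU'.
exists W; split=> //; split=> [w /WU|]; first exact: UU'.
by exists v => //; exact: UU'.
Qed.

Lemma hc_monol r P P' U : subp P' P -> hc r P U -> hc r P' U.
Proof.
move=> PP'; elim: r U => [|r IH] U /=; first by move=> PU v /PP'; exact: PU.
by move=> [W [sW /IH h WU]]; exists W.
Qed.

Lemma hc_leq r t P U : (t <= r)%N -> hc r P U -> hc t P U.
Proof.
elim: r U => [|r IH] U; first by rewrite leqn0 => /eqP ->.
rewrite leq_eqVlt => /orP[/eqP -> //|]; rewrite ltnS => tr /= [W [sW h [WU _]]].
by apply: hc_monor WU _; exact: IH.
Qed.

Lemma hc_cat a b P W U : hc a P W -> hc b W U -> hc (b + a) P U.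
Proof.
move=> hP; elim: b U => [|b IH] U /=; first by move=> WU; exact: hc_monor hP.
by move=> [W' [sW' /IH h ss]]; exists W'.
Qed.

(** Each strict step of the chain stays strict after intersecting with [W] or after adding [W]: by
    the modular law, a step lost in the intersection survives in the sum. *)
Lemma hc_split r P W U : submodp P -> submodp W -> submodp U -> hc r P U ->
  exists a b, [/\ (a + b)%N = r, hc a (capsm P W) (capsm U W)
                & hc b (sumsm P W) (sumsm U W)].
Proof.
move=> sP sW; elim: r U => [|r IH] U sU /=.
  move=> PU; exists 0%N, 0%N; split=> // v.
    by move=> [/PU].
  by move=> [p [q [/PU Up Wq ->]]]; exists p, q.
move=> [U' [sU' hU' [U'U [v Uv nU'v]]]].
have [a [b [ab ha hb]]] := IH U' sU' hU'.
have cc : subp (capsm U' W) (capsm U W) by move=> w [/U'U].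
have ss : subp (sumsm U' W) (sumsm U W).
  by move=> _ [p [q [/U'U Up Wq ->]]]; exists p, q.
have [[w [Uw Ww] nw]|no] := pselect (exists2 w, capsm U W w & ~ capsm U' W w).
  exists a.+1, b; split; [by rewrite addSn ab| |exact: hc_monor ss hb].
  exists (capsm U' W); split=> //; first exact: submodp_cap.
  by split=> //; exists w.
exists a, b.+1; split; [by rewrite addnS ab|exact: hc_monor cc ha|].
exists (sumsm U' W); split=> //; first exact: submodp_sumsm.
split=> //; exists v; first by exists v, 0; rewrite addr0; split=> //; case: sW.
move=> [p [q [U'p Wq vE]]]; apply: nU'v; rewrite vE; apply: submodpD => //.
have [//|nq] := pselect (U' q); case: no; exists q; last by case.
by split=> //; rewrite -[q](addKr p) -vE addrC; apply: submodpB => //; exact: U'U.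
Qed.

(** The length of U/P as a relation: it holds for no [r] when the length is infinite or when [P] is
    not inside [U]. *)
Definition flen P U r := hc r P U /\ forall t, hc t P U -> (t <= r)%N.

Lemma flen_sub P U r : flen P U r -> subp P U.
Proof. by case=> /hc_sub. Qed.

Lemma flen_uniq P U r t : flen P U r -> flen P U t -> r = t.
Proof. by move=> [h1 m1] [h2 m2]; apply/eqP; rewrite eqn_leq m1// m2. Qed.

Lemma flen_ex P U r : subp P U -> (forall t, hc t P U -> (t <= r)%N) ->
  exists2 t, flen P U t & (t <= r)%N.
Proof.
move=> PU m; have ex : exists t, `[< hc t P U >] by exists 0%N; apply/asboolP.
have ub t : `[< hc t P U >] -> (t <= r)%N by move/asboolP/m.
case: (ex_maxnP ex ub) => t /asboolP ht mt; exists t; last exact: m.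
by split=> // t' /asboolP /mt.
Qed.

(** Concatenating chains gives the lower bound, and splitting a chain along [W] the upper one. *)
Lemma flen_add P W U a b : submodp P -> submodp W -> submodp U ->
  flen P W a -> flen W U b -> flen P U (a + b).
Proof.
move=> sP sW sU [ha ma] [hb mb].
have PW := hc_sub ha; have WU := hc_sub hb.
split; first by rewrite addnC; exact: hc_cat hb.
move=> t /(hc_split sP sW sU) [a' [b' [<- h1 h2]]]; apply: leq_add.
  apply: ma; apply: (@hc_monor _ _ (capsm U W)); first by move=> v [].
  by apply: hc_monol h1 => v Pv; split=> //; exact: PW.
apply: mb; apply: (@hc_monor _ _ (sumsm U W)); first exact: sumsm_sub.
by apply: hc_monol h2; exact: subp_sumr.
Qed.

Lemma flen_split P W U r : submodp P -> submodp W -> submodp U ->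
  subp P W -> subp W U -> flen P U r ->
  exists a b, [/\ (a + b)%N = r, flen P W a & flen W U b].
Proof.
move=> sP sW sU PW WU hr.
have [a ha _] : exists2 a, flen P W a & (a <= r)%N.
  by apply: flen_ex => // t ht; apply: hr.2; exact: hc_monor ht.
have [b hb _] : exists2 b, flen W U b & (b <= r)%N.
  by apply: flen_ex => // t ht; apply: hr.2; exact: hc_monol ht.
exists a, b; split=> //; apply: flen_uniq hr; exact: flen_add ha hb.
Qed.

Lemma flen0 P U : subp P U -> subp U P -> flen P U 0.
Proof.
move=> PU UP; split=> // t; case: t => // t /= [W [_ /hc_sub PW [_ [v Uv nWv]]]].
by case: nWv; apply: PW; exact: UP.
Qed.

Lemma flen0_sub P U : submodp P -> flen P U 0 -> subp U P.
Proof.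
move=> sP [PU m] v Uv; have [//|nPv] := pselect (P v).
suff /m : hc 1 P U by [].
by exists P; split=> //; split=> //; exists v.
Qed.

Lemma flen_eq P P' U U' r : (forall v, P v <-> P' v) -> (forall v, U v <-> U' v) ->
  flen P U r -> flen P' U' r.
Proof.
move=> PP' UU' [h m]; split=> [|t ht].
  by apply: hc_monor (fun v => (UU' v).1) _; apply: hc_monol h => v /PP'.
by apply: m; apply: hc_monor (fun v => (UU' v).2) _; apply: hc_monol ht => v /PP'.
Qed.

Lemma hc_has_chain r U : submodp U -> hc r zerosm U -> exists N : nat -> submodClosed V,
  (forall i, (i < r)%N -> {subset N i <= N i.+1} /\ ~ (N i =i N i.+1))
  /\ forall v, (v \in N r) <-> U v.
Proof.
elim: r U => [|r IH] U sU /=.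
  by move=> _; exists (fun=> Defs.span U : submodClosed V); split=> // v; rewrite in_span.
move=> [W [sW /(IH W sW) [N [sN NW]] [WU [v Uv nWv]]]].
exists (fun i => if (i <= r)%N then N i else (Defs.span U : submodClosed V)); split; last first.
  by move=> w; rewrite ltnn in_span.
move=> i; rewrite ltnS => ir; rewrite ir; case: (ltngtP i r) ir => // [ir _|->] //; first exact: sN.
move=> _; split=> [w /NW /WU|E]; first by rewrite in_span.
by apply: nWv; apply/NW; rewrite E in_span.
Qed.

Lemma has_chain_hc r : has_chain (fun _ : submodClosed V => True) r -> hc r zerosm allsm.
Proof.
move=> [N [_ sN]]; apply: (@hc_monor _ _ (fun v => v \in N r)) => //.
have: (r <= r)%N by []; elim: {-2}r => [|i IH] ir; first by move=> v ->; exact: rpred0.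
exists (fun v => v \in N i); split; [exact: submodp_mem|by apply: IH; exact: ltnW|].
have [s ne] := sN _ ir; split=> //.
have [//|no] := pselect (exists2 v, v \in N i.+1 & v \notin N i).
  by move=> [v v1 /negP v2]; exists v.
case: ne => v; apply/idP/idP => [/s//|v1].
by have [//|v2] := boolP (v \in N i); case: no; exists v.
Qed.

Lemma chain_heightE (P : submodClosed V -> Prop) r : has_chain P r ->
  (forall t, has_chain P t -> (t <= r)%N) -> chain_height P = r%:Z%:E.
Proof.
move=> h m; rewrite /chain_height; case: pselect => [ex|[]]; last by exists r.
case: (cid ex) => /= t [ht mt]; congr (_%:Z%:E).
by apply/eqP; rewrite eqn_leq m// mt.
Qed.

Lemma mlength_flen r : flen zerosm allsm r -> mlength V = r%:Z%:E.
Proof.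
move=> [h m]; apply: chain_heightE => [|t /has_chain_hc]; last exact: m.
by have [N [sN _]] := hc_has_chain submodp_all h; exists N.
Qed.

End Submodule.

Arguments zerosm {R V}.
Arguments allsm {R V}.
Arguments submodp_zero {R V}.
Arguments submodp_all {R V}.

(** * Isomorphic subquotients; kernel and cokernel of a multiplication *)

Section SubquotientIso.
Variable R : comNzRingType.
Implicit Types X Y Z : lmodType R.

Definition linrel X Y (rho : X -> Y -> Prop) := rho 0 0 /\
  forall a u v u' v', rho u u' -> rho v v' -> rho (a *: u + v) (a *: u' + v').

(* An isomorphism between the subquotients U/V of X and U'/V' of Y, given as a
   linear correspondence so that connecting maps need no choice of lifts. *)
Definition sqiso X Y (U V : X -> Prop) (U' V' : Y -> Prop) :=
  exists rho : X -> Y -> Prop,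
  [/\ linrel rho,
      forall u, U u -> exists2 u', U' u' & rho u u',
      forall u', U' u' -> exists2 u, U u & rho u u'
    & forall u u', U u -> U' u' -> rho u u' -> (V u <-> V' u')].

Lemma sqiso_sym X Y (U V : X -> Prop) (U' V' : Y -> Prop) :
  sqiso U V U' V' -> sqiso U' V' U V.
Proof.
move=> [rho [[r0 rl] t s e]]; exists (fun y x => rho x y); split=> //.
  by split=> // a u v u' v'; exact: rl.
by move=> u u' Uu Uu' r; split=> /(e _ _ Uu' Uu r).
Qed.

Lemma sqiso_trans X Y Z (U V : X -> Prop) (U' V' : Y -> Prop) (U'' V'' : Z -> Prop) :
  submodp U' -> sqiso U V U' V' -> sqiso U' V' U'' V'' -> sqiso U V U'' V''.
Proof.
move=> sU' [r [[r0 rl] rt rs re]] [q [[q0 ql] qt qs qe]].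
exists (fun x z => exists y, [/\ U' y, r x y & q y z]); split.
- split; first by exists 0; split=> //; case: sU'.
  move=> a u v u' v' [y [Uy ry qy]] [y' [Uy' ry' qy']].
  by exists (a *: y + y'); split; [apply sU'|exact: rl|exact: ql].
- by move=> u /rt[y Uy ry]; have [z Uz qz] := qt _ Uy; exists z => //; exists y.
- by move=> z /qs[y Uy qy]; have [u Uu ru] := rs _ Uy; exists u => //; exists y.
- move=> u z Uu Uz [y [Uy ry qy]].
  by rewrite (re _ _ Uu Uy ry) (qe _ _ Uy Uz qy).
Qed.

Lemma sqiso_hc X Y (U V : X -> Prop) (U' V' : Y -> Prop) r :
  submodp U -> submodp V -> submodp U' -> subp V' U' ->
  sqiso U V U' V' -> hc r V U -> hc r V' U'.
Proof.
move=> sU sV sU' VU' [rho [[r0 rl] t s e]].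
pose im W u' := U' u' /\ exists2 u, W u & rho u u'.
have sim W : submodp W -> submodp (im W).
  move=> [W0 sW]; split; first by split; [case: sU'|exists 0].
  move=> a u v [Uu [x Wx rx]] [Uv [y Wy ry]].
  by split; [apply sU'|exists (a *: x + y); [exact: sW|exact: rl]].
have imV W : hc 0 V W -> hc 0 V' (im W).
  move=> VW v V'v; split; first exact: VU'.
  have [u Uu ru] := s _ (VU' _ V'v); exists u => //.
  by apply: VW; apply/(e _ _ Uu (VU' _ V'v) ru).
suff H W : subp W U -> hc r V W -> hc r V' (im W).
  by move=> h; apply: (@hc_monor _ _ _ _ (im U)); [move=> v []|exact: H].
elim: r W => [|r IH] W WU; first by move=> h; exact: imV.
move=> [W1 [sW1 h1 [WW [v Wv nWv]]]].
exists (im W1); split; [exact: sim|by apply: IH => // w /WW /WU|].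
split=> [w [Uw [x /WW]]|]; first by split=> //; exists x.
have [v' Uv' rv] := t _ (WU _ Wv); exists v'; first by split=> //; exists v.
(* Strictness survives: [v] and [x] share the partner [v'], so [v - x] is related to 0 and hence
   lies in [V], which is below the chain. *)
move=> [_ [x W1x rx]]; apply: nWv; rewrite -[v](subrK x).
apply: submodpD => //; apply: (hc_sub h1).
have r1 : rho (v - x) 0.
  by rewrite addrC -(addNr v') -!scaleN1r; exact: rl.
have U0 := submodp0 sU; have U'0 := submodp0 sU'.
apply/(e _ 0 _ U'0 r1); first by apply: submodpB => //; [exact: WU|exact/WU/WW].
by apply/(e _ _ U0 U'0 r0); case: sV.
Qed.

Lemma sqiso_flen X Y (U V : X -> Prop) (U' V' : Y -> Prop) r :
  submodp U -> submodp V -> submodp U' -> submodp V' -> subp V U -> subp V' U' ->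
  sqiso U V U' V' -> flen V U r -> flen V' U' r.
Proof.
move=> sU sV sU' sV' VU VU' i [h m]; split=> [|t ht]; first exact: sqiso_hc i h.
by apply: m; apply: (sqiso_hc sU' sV' sU VU (sqiso_sym i) ht).
Qed.

(* The preimages in U of the kernel and of the image of y on U/V. *)
Definition kery X (y : R) (U V : X -> Prop) u := U u /\ V (y *: u).
Definition imy X (y : R) (U V : X -> Prop) w := exists u v, [/\ U u, V v & w = v + y *: u].

Lemma submodp_kery X y (U V : X -> Prop) : submodp U -> submodp V -> submodp (kery y U V).
Proof.
move=> [U0 sU] [V0 sV]; split; first by split; rewrite ?scaler0.
move=> a u v [Uu Vu] [Uv Vv]; split; first exact: sU.
by rewrite scalerDr scalerA mulrC -scalerA; exact: sV.
Qed.

Lemma submodp_imy X y (U V : X -> Prop) : submodp U -> submodp V -> submodp (imy y U V).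
Proof.
move=> [U0 sU] [V0 sV]; split; first by exists 0, 0; rewrite scaler0 addr0.
move=> a _ _ [u [v [Uu Vv ->]]] [u' [v' [Uu' Vv' ->]]].
exists (a *: u + u'), (a *: v + v'); split; [exact: sU|exact: sV|].
by rewrite !scalerDr !scalerA [y * a]mulrC addrACA.
Qed.

Lemma sub_kery X y (U V : X -> Prop) : submodp V -> subp V U -> subp V (kery y U V).
Proof. by move=> sV VU v Vv; split; [exact: VU|exact: submodpZ]. Qed.

Lemma sub_imy X y (U V : X -> Prop) : submodp U -> subp V (imy y U V).
Proof. by move=> [U0 _] v Vv; exists 0, v; rewrite scaler0 addr0. Qed.

Lemma imy_sub X y (U V : X -> Prop) : submodp U -> subp V U -> subp (imy y U V) U.
Proof.
by move=> sU VU _ [u [v [Uu /VU Uv ->]]]; apply: submodpD => //; exact: submodpZ.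
Qed.

Lemma kery_sqiso X Y y (U V : X -> Prop) (U' V' : Y -> Prop) :
  submodp U -> submodp U' -> sqiso U V U' V' -> sqiso (kery y U V) V (kery y U' V') V'.
Proof.
move=> sU sU' [rho [[r0 rl] t s e]].
have yr u u' : rho u u' -> rho (y *: u) (y *: u').
  by move=> r; rewrite -[y *: u]addr0 -[y *: u']addr0; exact: rl.
exists rho; split=> //.
- move=> u [Uu Vyu]; have [u' Uu' r] := t _ Uu; exists u' => //; split=> //.
  by apply/(e (y *: u) _ _ _ (yr _ _ r)) => //; exact: submodpZ.
- move=> u' [Uu' Vyu]; have [u Uu r] := s _ Uu'; exists u => //; split=> //.
  by apply/(e _ (y *: u') _ _ (yr _ _ r)) => //; exact: submodpZ.
- by move=> u u' [Uu _] [Uu' _]; exact: e.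
Qed.

Lemma sqiso_kill X Y y (U V : X -> Prop) (U' V' : Y -> Prop) :
  submodp U -> submodp U' -> sqiso U V U' V' ->
  (forall u, U u -> V (y *: u)) -> forall u', U' u' -> V' (y *: u').
Proof.
move=> sU sU' [rho [[r0 rl] t s e]] k u' Uu'; have [u Uu r] := s _ Uu'.
apply/(e (y *: u)); [exact: submodpZ|exact: submodpZ| |exact: k].
by rewrite -[y *: u]addr0 -[y *: u']addr0; exact: rl.
Qed.

(** The first isomorphism theorem for y acting on U/V. *)
Lemma mul_sqiso X y (U V : X -> Prop) : submodp U -> submodp V ->
  sqiso U (kery y U V) (imy y U V) V.
Proof.
move=> sU sV; exists (fun u w => exists2 v, V v & w = v + y *: u); split.
- split; first by exists 0; [case: sV|rewrite scaler0 addr0].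
  move=> a u u' w w' [v Vv ->] [v' Vv' ->]; exists (a *: v + v'); first by apply sV.
  by rewrite !scalerDr !scalerA [y * a]mulrC addrACA.
- move=> u Uu; exists (y *: u); last by exists 0; [case: sV|rewrite add0r].
  by exists u, 0; split=> //; [case: sV|rewrite add0r].
- by move=> _ [u [v [Uu Vv ->]]]; exists u => //; exists v.
- move=> u w Uu _ [v Vv ->]; split=> [[_ Vyu]|Vw]; first exact: submodpD.
  by split=> //; rewrite -[_ *: _](addKr v) addrC; exact: submodpB.
Qed.

(** Both lengths equal the length of U/V minus that of y(U/V). *)
Lemma flen_ker_coker X y (U V : X -> Prop) r : submodp U -> submodp V -> flen V U r ->
  exists2 e, flen V (kery y U V) e & flen (imy y U V) U e.
Proof.
move=> sU sV h; have VU := flen_sub h.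
have sK := submodp_kery y sU sV; have sI := submodp_imy y sU sV.
have kU : subp (kery y U V) U by move=> u [].
have [e [f [ef he hf]]] := flen_split sV sK sU (sub_kery y sV VU) kU h.
have [f' [e' [fe hf' he']]] := flen_split sV sI sU (@sub_imy _ y _ _ sU) (@imy_sub _ y _ _ sU VU) h.
have h1 := sqiso_flen sU sK sI sV kU (@sub_imy _ y _ _ sU) (@mul_sqiso _ y _ _ sU sV) hf.
exists e => //; have E := flen_uniq hf' h1; suff -> : e = e' by [].
by apply/eqP; rewrite -(eqn_add2r f) ef -fe E addnC.
Qed.

End SubquotientIso.

(** * Tensor products *)

Section FreeModule.
Variables (R : comNzRingType) (K : choiceType).
Implicit Types D : {freeg K / R}.

Lemma freegUZ (a : R) (k : K) : << a *g k >> = a *: << k >> :> {freeg K / R}.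
Proof. by apply/eqP/freeg_eqP => z; rewrite coeffZ !coeffU mul1r. Qed.

Lemma freeg_sum_sup D (s : seq K) : uniq s -> {subset dom D <= s} ->
  D = \sum_(k <- s) coeff k D *: << k >>.
Proof.
move=> us sub; apply/eqP/freeg_eqP => z; rewrite raddf_sum /=.
have E k : coeff z (coeff k D *: << k >>) = coeff k D * (z == k)%:R.
  by rewrite coeffZ coeffU mul1r eq_sym.
under eq_bigr do rewrite E.
have [zs|zs] := boolP (z \in s).
  rewrite (bigD1_seq z) //= eqxx mulr1 big1 ?addr0// => k.
  by rewrite eq_sym => /negPf ->; rewrite mulr0.
rewrite coeff_outdom; last by apply: contra zs; exact: sub.
rewrite big_seq big1// => k ks.
have -> : (z == k) = false by apply: contraNF zs => /eqP ->.
by rewrite mulr0.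
Qed.

End FreeModule.

Section TensorTheory.
Variable R : comNzRingType.
Implicit Types A B C L M N : lmodType R.

Lemma tens_ind M N (P : tensor M N -> Prop) :
  submodp P -> (forall m n, P (tens m n)) -> forall t, P t.
Proof.
move=> sP Pt t; pose q := qmod (Defs.span (@bilin_rel R M N)).
have -> : t = \pi_q (repr (t : q)) by rewrite reprK.
rewrite -(freeg_sumE (repr (t : q))) raddf_sum.
apply: submodp_sum => // -[m n].
set D := repr _; rewrite freegUZ.
have E : \pi_q (coeff (m, n) D *: << (m, n) >>) = coeff (m, n) D *: tens m n by exact: pi_scale.
by have := submodpZ (coeff (m, n) D) sP (Pt m n); rewrite -E.
Qed.

Lemma tens_ext L M N (f g : {linear tensor M N -> L}) :
  (forall m n, f (tens m n) = g (tens m n)) -> forall t, f t = g t.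
Proof.
move=> fg; apply: (@tens_ind _ _ (fun t => f t = g t)) => //; split.
  by rewrite !linear0.
by move=> a u v E1 E2; rewrite !linearP E1 E2.
Qed.

Section Lift.
Variables (L M N : lmodType R) (b : M -> N -> L).
Hypothesis bl : forall n, linear (b^~ n).
Hypothesis br : forall m, linear (b m).

Let pre : {linear {freeg (M * N)%type / R} -> L} :=
  free_lift (fun p : M * N => b p.1 p.2).

Definition tlift (t : tensor M N) : L :=
  pre (repr (t : qmod (Defs.span (@bilin_rel R M N)))).

Let pre0 x : x \in Defs.span (@bilin_rel R M N) -> pre x = 0.
Proof.
have U m n : pre << (m, n) >> = b m n by rewrite [LHS]free_liftU scale1r.
have blD n m m' : b (m + m') n = b m n + b m' n.
  by rewrite -{1}[m]scale1r bl scale1r.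
have brD m n n' : b m (n + n') = b m n + b m n'.
  by rewrite -{1}[n]scale1r br scale1r.
have bl0 n : b 0 n = 0 by apply: (addrI (b 0 n)); rewrite -blD !addr0.
have br0 m : b m 0 = 0 by apply: (addrI (b m 0)); rewrite -brD !addr0.
have V y : bilin_rel y -> pre y = 0.
  case=> [m m' n|m n n'|a m n|a m n]; rewrite !linearB ?linearZ_LR /= !U.
  - by rewrite blD addrAC addrK subrr.
  - by rewrite brD addrAC addrK subrr.
  - by rewrite -[a *: m]addr0 bl bl0 addr0 scalerN subrr.
  - by rewrite -[a *: n]addr0 br br0 addr0 scalerN subrr.
move=> /asboolP[s sX ->]; rewrite linear_sum big_seq big1// => p /sX Xp.
by rewrite linearZ_LR V// scaler0.
Qed.

Let pi_tlift x : tlift (\pi_(qmod (Defs.span (@bilin_rel R M N))) x) = pre x.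
Proof.
rewrite /tlift; set y := repr _; apply/eqP; rewrite -subr_eq0 -linearB.
by apply/eqP/pre0/qmod_eqP; rewrite /y reprK.
Qed.

Lemma tlift_tens m n : tlift (tens m n) = b m n.
Proof. by rewrite pi_tlift [LHS]free_liftU scale1r. Qed.

Lemma tlift_is_linear : linear tlift.
Proof.
move=> a u v; pose q := qmod (Defs.span (@bilin_rel R M N)).
have -> : u = \pi_q (repr (u : q)) by rewrite reprK.
have -> : v = \pi_q (repr (v : q)) by rewrite reprK.
rewrite -[X in tlift (X + _)]pi_scale -raddfD !pi_tlift.
exact: linearP.
Qed.

Lemma tens_univ : exists h : {linear tensor M N -> L}, forall m n, h (tens m n) = b m n.
Proof.
pose lin := GRing.isLinear.Build R (tensor M N) L *:%R tlift tlift_is_linear.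
pose h : {linear tensor M N -> L} := HB.pack tlift lin.
by exists h; exact: tlift_tens.
Qed.

End Lift.

Lemma tens0l M N (n : N) : tens (0 : M) n = 0.
Proof. by rewrite -(scale0r (0 : M)) tensZl scale0r. Qed.

Lemma tens0r M N (m : M) : tens m (0 : N) = 0.
Proof. by rewrite -(scale0r (0 : N)) tensZr scale0r. Qed.

Lemma tens_linl M N (n : N) : linear (fun m : M => tens m n).
Proof. by move=> a u v; rewrite tensDl tensZl. Qed.

Lemma tens_linr M N (m : M) : linear (fun n : N => tens m n).
Proof. by move=> a u v; rewrite tensDr tensZr. Qed.

Definition tswap M N : {linear tensor M N -> tensor N M} :=
  projT1 (cid (@tens_univ _ M N (fun m n => tens n m)
    (fun n => @tens_linr N M n) (fun m => @tens_linl N M m))).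

Lemma tswap_tens M N (m : M) (n : N) : tswap M N (tens m n) = tens n m.
Proof. by rewrite /tswap; case: cid. Qed.

Lemma tswapK M N t : tswap N M (tswap M N t) = t.
Proof.
by apply: (tens_ext (f := tswap N M \o tswap M N) (g := idfun)) => m n /=; rewrite !tswap_tens.
Qed.

(** Conjugating by the swap carries surjectivity and right exactness over from [tmap]. *)
Definition tmapr M N N' (g : {linear N -> N'}) (t : tensor M N) : tensor M N' :=
  tswap N' M (tmap M g (tswap M N t)).
Arguments tmapr M {N N'} g t : simpl never.

Lemma tmapr_is_linear M N N' (g : {linear N -> N'}) : linear (tmapr M g).
Proof. by move=> a u v; rewrite /tmapr !linearP. Qed.
HB.instance Definition _ M N N' (g : {linear N -> N'}) :=
  GRing.isLinear.Build R (tensor M N) (tensor M N') *:%R (tmapr M g) (tmapr_is_linear g).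

Lemma tmapr_tens M N N' (g : {linear N -> N'}) m n : tmapr M g (tens m n) = tens m (g n).
Proof. by rewrite /tmapr tswap_tens tmap_tens tswap_tens. Qed.

Lemma tswap_tmapr M N N' (g : {linear N -> N'}) t :
  tswap M N' (tmapr M g t) = tmap M g (tswap M N t).
Proof. exact: tswapK. Qed.

Lemma tswap_tmap M N N' (g : {linear N -> N'}) t :
  tswap N' M (tmap M g t) = tmapr M g (tswap N M t).
Proof. by rewrite /tmapr tswapK. Qed.

Lemma tmap_tmapr M M' N N' (f : {linear M -> M'}) (g : {linear N -> N'}) t :
  tmap N' f (tmapr M g t) = tmapr M' g (tmap N f t).
Proof.
apply: (tens_ext (f := tmap N' f \o tmapr M g) (g := tmapr M' g \o tmap N f)) => m n.
by rewrite /= !(tmapr_tens, tmap_tens).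
Qed.

Definition imsm M N (f : M -> N) y := exists x, f x = y.

Lemma submodp_imsm M N (f : {linear M -> N}) : submodp (imsm f).
Proof.
split; first by exists 0; rewrite linear0.
by move=> a _ _ [x <-] [y <-]; exists (a *: x + y); rewrite linearP.
Qed.

Lemma tmap_surj M M' N (f : {linear M -> M'}) :
  (forall y, exists x, f x = y) -> forall t, exists s, tmap N f s = t.
Proof.
move=> sf; apply: (tens_ind (submodp_imsm (tmap N f))) => m n.
by have [x <-] := sf m; exists (tens x n); exact: tmap_tens.
Qed.

Lemma tmapr_surj M N N' (g : {linear N -> N'}) :
  (forall y, exists x, g x = y) -> forall t, exists s, tmapr M g s = t.
Proof.
move=> sg t; have [s E] := tmap_surj sg (tswap M N' t).
by exists (tswap N M s); rewrite /tmapr tswapK E tswapK.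
Qed.

Lemma submodp_ker M N (f : {linear M -> N}) : submodp (fun x => f x = 0).
Proof. by split=> [|a u v fu fv]; rewrite ?linear0// linearP fu fv scaler0 addr0. Qed.

(* A set-theoretic section of g induces C (x) N -> (B (x) N) / im (A (x) N), left
   inverse to the map induced by g. *)
Lemma tmap_exact A B C N (f : {linear A -> B}) (g : {linear B -> C}) :
  (forall y, exists x, g x = y) -> (forall x, g x = 0 -> imsm f x) ->
  forall t, tmap N g t = 0 -> imsm (tmap N f) t.
Proof.
move=> sg ex; pose Q := imsm (tmap N f); have sQ : submodp Q by exact: submodp_imsm.
pose S : submodClosed (tensor B N) := Defs.span Q.
have SE t : (t \in S) <-> Q t by exact: in_span.
pose sec c := projT1 (cid (sg c)).
have secK c : g (sec c) = c by rewrite /sec; case: cid.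
pose b c n : qmod S := \pi_(qmod S) (tens (sec c) n).
(* Another preimage of [g x] changes the tensor only by the image of [f]; hence [b] does not depend
   on the section, and this makes it bilinear although the section is not linear. *)
have bE x n : b (g x) n = \pi_(qmod S) (tens x n).
  apply/qmod_eqP/SE; have [|a fa] := ex (sec (g x) - x).
    by rewrite linearB secK subrr.
  exists (tens a n); rewrite [LHS]tmap_tens fa -scaleN1r tensDl tensZl scaleN1r.
  by [].
have bl n : linear (b^~ n).
  move=> a u v; rewrite -(secK u) -(secK v) -linearP !bE -linearP.
  by rewrite tensDl tensZl.
have br c : linear (b c).
  by move=> a u v; rewrite /b tensDr tensZr linearP.
have [h hE] := tens_univ bl br.
move=> t gt; apply/SE.
have /(tens_ext (f := h \o tmap N g) (g := \pi_(qmod S))) /(_ t) : forall x n,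
    (h \o tmap N g) (tens x n) = \pi_(qmod S) (tens x n).
  by move=> x n; rewrite /= tmap_tens hE bE.
rewrite /= gt linear0 => E; rewrite -[t]subr0; apply/qmod_eqP.
by rewrite -E linear0.
Qed.

Lemma tmapr_exact A B C M (f : {linear A -> B}) (g : {linear B -> C}) :
  (forall y, exists x, g x = y) -> (forall x, g x = 0 -> imsm f x) ->
  forall t, tmapr M g t = 0 -> imsm (tmapr M f) t.
Proof.
move=> sg ex t gt.
have [|x E] := tmap_exact sg ex (N := M) (t := tswap M B t).
  by rewrite -tswap_tmapr gt linear0.
by exists (tswap A M x); rewrite -[LHS]tswap_tmap [tmap _ _ _]E tswapK.
Qed.

Section Coordinates.
Variables (S N : lmodType R).

Lemma tcoef_ex (k : S) : exists h : {linear tensor (free_on S) N -> N},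
  forall D n, h (tens D n) = coeff k D *: n.
Proof.
apply: tens_univ => [n a u v|D a u v].
  by rewrite coeffD coeffZ scalerDl scalerA.
by rewrite scalerDr !scalerA mulrC.
Qed.

Definition tcoef (k : S) := projT1 (cid (tcoef_ex k)).

Lemma tcoef_tens k D n : tcoef k (tens D n) = coeff k D *: n.
Proof. by rewrite /tcoef; case: cid. Qed.

(** Quantifying over every larger list makes the property stable under sums, where two supports have
    to be merged. *)
Lemma tcoef_sum t : exists s : seq S, forall s', uniq s' -> {subset s <= s'} ->
  t = \sum_(k <- s') tens (<< k >> : free_on S) (tcoef k t).
Proof.
move: t; apply: tens_ind => [|D n]; first split.
- exists [::] => s _ _; rewrite big1// => k _.
  by rewrite linear0 tens0r.
- move=> a u v [s1 H1] [s2 H2]; exists (s1 ++ s2) => s us sub.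
  have /(H1 s us) u1 : {subset s1 <= s} by move=> x xs; apply: sub; rewrite mem_cat xs.
  have /(H2 s us) v1 : {subset s2 <= s} by move=> x xs; apply: sub; rewrite mem_cat xs orbT.
  rewrite {1}u1 {1}v1.
  rewrite scaler_sumr -big_split /=; apply: eq_bigr => k _.
  by rewrite linearP tensDr tensZr.
- exists (dom D) => s us sub; rewrite {1}(freeg_sum_sup us sub).
  transitivity (\sum_(k <- s) tens (coeff k D *: << k >> : free_on S) n).
    elim: s {us sub} => [|k s IH]; last by rewrite !big_cons tensDl IH.
    by rewrite !big_nil tens0l.
  by apply: eq_bigr => k _; rewrite tcoef_tens tensZr tensZl.
Qed.

Lemma tcoef_eq0 t : (forall k, tcoef k t = 0) -> t = 0.
Proof.
move=> t0; have [s H] := tcoef_sum t; rewrite (H (undup s)) ?undup_uniq//.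
  by rewrite big1// => k _; rewrite t0 tens0r.
by move=> x; rewrite mem_undup.
Qed.

End Coordinates.

Lemma tcoef_tmapr (S : lmodType R) N N' (g : {linear N -> N'}) (k : S) t :
  tcoef N' k (tmapr (free_on S) g t) = g (tcoef N k t).
Proof.
apply: (tens_ext (f := tcoef N' k \o tmapr (free_on S) g) (g := g \o tcoef N k)) => D n /=.
by rewrite tmapr_tens !tcoef_tens linearZ.
Qed.

Lemma free_flatr (S : lmodType R) N N' (g : {linear N -> N'}) : (forall x, g x = 0 -> x = 0) ->
  forall t, tmapr (free_on S) g t = 0 -> t = 0.
Proof.
move=> ig t gt; apply: tcoef_eq0 => k; apply: ig.
by rewrite -tcoef_tmapr gt linear0.
Qed.

Lemma free_flatl (S : lmodType R) N N' (g : {linear N -> N'}) : (forall x, g x = 0 -> x = 0) ->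
  forall t, tmap (free_on S) g t = 0 -> t = 0.
Proof.
move=> ig t gt; rewrite -[t]tswapK (free_flatr ig (t := tswap _ _ t)) ?linear0//.
by rewrite -tswap_tmap gt linear0.
Qed.

End TensorTheory.
Arguments tmapr {R} M {N N'} g t : simpl never.

(** * Symmetry of Tor *)

Section TorSymmetry.
Variable R : comNzRingType.
Implicit Types M N : lmodType R.

Definition kaug M : {linear ker_aug M -> free_on M} := val : ker_aug M -> free_on M.
Arguments kaug : simpl never.

Lemma kaug_inj M x : kaug M x = 0 -> x = 0.
Proof. by move=> x0; apply: val_inj; rewrite [LHS]x0 raddf0. Qed.

Lemma aug_kaug M x : aug M (kaug M x) = 0.
Proof. by case: x => x /= /eqP. Qed.

Lemma kaug_exact M x : aug M x = 0 -> imsm (kaug M) x.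
Proof.
move=> x0; have kx : x \in kerp (aug M) by rewrite unfold_in /kerp x0.
by exists (Kermod kx : ker_aug M).
Qed.

(* Tor_1(M,N), through the syzygy of M. *)
Definition tau M N (t : tensor (ker_aug M) N) : Prop := tmap N (kaug M) t = 0.

Lemma submodp_tau M N : submodp (@tau M N).
Proof. exact: submodp_ker. Qed.

(* With A, B the syzygies of M, N inside the free modules F, G, the group
   Tor_1(M,N) is the symmetric (A (x) G) cap (F (x) B) / (A (x) B). *)
Definition mid M N (w : tensor (free_on M) (free_on N)) : Prop :=
  imsm (tmap (free_on N) (kaug M)) w /\ imsm (tmapr (free_on M) (kaug N)) w.

Definition mid0 M N (w : tensor (free_on M) (free_on N)) : Prop :=
  exists c : tensor (ker_aug M) (ker_aug N),
    w = tmap (free_on N) (kaug M) (tmapr (ker_aug M) (kaug N) c).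

Lemma submodp_mid M N : submodp (@mid M N).
Proof. by apply: submodp_cap; exact: submodp_imsm. Qed.

(** An element of A (x) G has an image in A (x) N and one in F (x) G. The first dies in F (x) N
    exactly when the second does, that is, when the second comes from F (x) B. *)
Lemma tau_mid M N : sqiso (@tau M N) zerosm (@mid M N) (@mid0 M N).
Proof.
exists (fun t w => exists a, t = tmapr (ker_aug M) (aug N) a /\
                   w = tmap (free_on N) (kaug M) a); split.
- split; first by exists 0; rewrite !linear0.
  by move=> a _ _ _ _ [x [-> ->]] [y [-> ->]]; exists (a *: x + y); rewrite !linearP.
- move=> t tt; have [a aE] := tmapr_surj (@aug_surj R N) t.
  exists (tmap (free_on N) (kaug M) a); last by exists a.
  split; first by exists a.
  apply: (tmapr_exact (@aug_surj R N) (@kaug_exact N)).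
  by rewrite -tmap_tmapr aE.
- move=> _ [[a <-] [b bE]]; exists (tmapr (ker_aug M) (aug N) a); last by exists a.
  rewrite /tau tmap_tmapr -bE.
  apply: (tens_ext (f := tmapr (free_on M) (aug N) \o tmapr (free_on M) (kaug N)) (g := \0)).
  by move=> m n /=; rewrite !tmapr_tens aug_kaug tens0r.
- move=> t w tt mw [a [tE wE]]; split=> [t0|[c cE]].
    have [|c cE] := tmapr_exact (@aug_surj R N) (@kaug_exact N) (t := a).
      by rewrite -tE t0.
    by exists c; rewrite wE cE.
  (* G is free, so A (x) G embeds into F (x) G. *)
  have E : a = tmapr (ker_aug M) (kaug N) c.
    apply/eqP; rewrite -subr_eq0; apply/eqP.
    apply: (free_flatl (@kaug_inj M)); rewrite linearB; apply/eqP.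
    by rewrite subr_eq0; apply/eqP; exact: etrans (esym wE) cE.
  rewrite tE E.
  apply: (tens_ext (f := tmapr (ker_aug M) (aug N) \o tmapr (ker_aug M) (kaug N)) (g := \0)).
  by move=> m n /=; rewrite !tmapr_tens aug_kaug tens0r.
Qed.

Lemma mid_swap M N : sqiso (@mid M N) (@mid0 M N) (@mid N M) (@mid0 N M).
Proof.
have sw M' N' w : @mid M' N' w -> @mid N' M' (tswap _ _ w).
  move=> [[a aE] [b bE]]; split.
    by exists (tswap _ _ b); rewrite -[LHS]tswap_tmapr [tmapr _ _ _]bE.
  by exists (tswap _ _ a); rewrite -[LHS]tswap_tmap [tmap _ _ _]aE.
have sw0 M' N' w : @mid0 M' N' w -> @mid0 N' M' (tswap _ _ w).
  move=> [c ->]; exists (tswap _ _ c).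
  by rewrite tmap_tmapr tswap_tmapr tswap_tmap.
exists (fun w w' => w' = tswap _ _ w); split.
- by split=> [|a u v _ _ -> ->]; rewrite ?linear0// linearP.
- by move=> w mw; exists (tswap _ _ w) => //; exact: sw.
- by move=> w mw; exists (tswap _ _ w); [exact: sw|rewrite tswapK].
- move=> w _ mw _ ->; split; first exact: sw0.
  by move/sw0; rewrite tswapK.
Qed.

Lemma tau_sym M N : sqiso (@tau M N) zerosm (@tau N M) zerosm.
Proof.
apply: (sqiso_trans (@submodp_mid M N) (tau_mid M N)).
apply: (sqiso_trans (@submodp_mid N M) (mid_swap M N)).
exact/sqiso_sym/tau_mid.
Qed.

(** After one use of symmetry both sides live in the tensor product of the two syzygies A and B, up
    to a swap. Both are then the kernel of A (x) B -> F (x) G, because F and G are flat. *)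
Lemma tau_shift M N :
  sqiso (@tau (ker_aug M) N) zerosm (@tau M (ker_aug N)) zerosm.
Proof.
apply: (sqiso_trans (@submodp_tau N (ker_aug M)) (tau_sym _ _)).
have H t : @tau N (ker_aug M) t <-> @tau M (ker_aug N) (tswap _ _ t).
  rewrite /tau; split=> t0.
    apply: (free_flatr (S := M) (@kaug_inj N)).
    by rewrite -tmap_tmapr -tswap_tmap t0 !linear0.
  rewrite -[LHS]tswapK tswap_tmap [tmapr _ _ _](_ : _ = 0) ?linear0//.
  apply: (free_flatl (S := N) (@kaug_inj M)).
  by rewrite tmap_tmapr t0 linear0.
exists (fun w w' => w' = tswap _ _ w); split.
- by split=> [|a u v _ _ -> ->]; rewrite ?linear0// linearP.
- by move=> t /H tt; exists (tswap _ _ t).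
- by move=> t tt; exists (tswap _ _ t); [apply/H; rewrite tswapK|rewrite tswapK].
- move=> t _ _ _ ->; rewrite /zerosm; split=> [->|E]; first by rewrite linear0.
  by rewrite -[t]tswapK E linear0.
Qed.

Lemma tau_shiftn M N i j :
  sqiso (@tau (syzygy M i) (syzygy N j)) zerosm (@tau M (syzygy N (i + j))) zerosm.
Proof.
elim: i j => [|i IH] j; first by rewrite add0n; exists eq; split=> //;
  [split=> // a u v _ _ <- <-|move=> u; exists u|move=> u; exists u|move=> u _ _ _ <-].
apply: (sqiso_trans (@submodp_tau (syzygy M i) (syzygy N j.+1))); first exact: tau_shift.
by rewrite addSnnS.
Qed.

Lemma homology_sq (C D E : lmodType R) (f : {linear C -> D}) (g : {linear D -> E}) :
  sqiso (allsm : homology_at f g -> Prop) zerosm (fun b => g b = 0) (imsm f).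
Proof.
pose q := qmod (boundary (g := g) f).
have piE (x : kermod g) : \pi_q x = 0 <-> imsm f (val x).
  split=> [e|H].
    have : x - 0 \in boundary (g := g) f by apply/qmod_eqP; rewrite e raddf0.
    by rewrite subr0 => /asboolP.
  have : x - 0 \in boundary (g := g) f by apply/asboolP; rewrite subr0.
  by move/qmod_eqP => e; rewrite [LHS]e raddf0.
exists (fun h b => exists2 x : kermod g, h = \pi_q x & val x = b); split.
- split; first by exists 0; rewrite ?raddf0.
  move=> a _ _ _ _ [x -> <-] [y -> <-]; exists (a *: x + y); last by rewrite linearP.
  by rewrite linearP.
- move=> h _; exists (val (repr (h : q))); last by exists (repr (h : q)); rewrite ?reprK.
  by case: (repr _) => b /= /eqP.
- move=> b b0; have kb : b \in kerp g by rewrite unfold_in /kerp b0.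
  by exists (\pi_q (Kermod kb)) => //; exists (Kermod kb).
- by move=> _ _ _ _ [x -> <-]; exact: piE.
Qed.

Lemma free_res_diffE M N i t : tmap N (free_res_diff M i) t =
  tmap N (kaug (syzygy M i)) (tmap N (aug (syzygy M i.+1)) t).
Proof.
apply: (tens_ext (f := tmap N (free_res_diff M i))
  (g := tmap N (kaug (syzygy M i)) \o tmap N (aug (syzygy M i.+1)))) => m n.
by rewrite [LHS]tmap_tens [RHS](congr1 _ (tmap_tens _ _ _)) [RHS]tmap_tens.
Qed.

Lemma imsm_diff M N i t : imsm (tmap N (free_res_diff M i)) t <-> tmap N (aug (syzygy M i)) t = 0.
Proof.
split=> [[s <-]|t0].
  rewrite free_res_diffE.
  apply: (tens_ext (f := tmap N (aug (syzygy M i)) \o tmap N (kaug (syzygy M i))) (g := \0)).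
  by move=> m n /=; rewrite !tmap_tens aug_kaug tens0l.
have [s <-] := tmap_exact (@aug_surj R _) (@kaug_exact (syzygy M i)) t0.
have [r <-] := tmap_surj (@aug_surj R (syzygy M i.+1)) s.
by exists r; exact: free_res_diffE.
Qed.

(** By right exactness, chains of degree i + 1 modulo boundaries form syzygy_(i+1) (x) N; the cycles
    become the kernel of its map to F_i (x) N. *)
Lemma Tor_tau M N i :
  sqiso (allsm : Tor i.+1 M N -> Prop) zerosm (@tau (syzygy M i) N) zerosm.
Proof.
apply: (sqiso_trans _ (homology_sq _ _)); first exact: submodp_ker.
exists (fun t s => s = tmap N (aug (syzygy M i.+1)) t); split.
- by split=> [|a u v _ _ -> ->]; rewrite ?linear0// linearP.
- move=> t t0; exists (tmap N (aug (syzygy M i.+1)) t) => //.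
  by have: tmap N (free_res_diff M i) t = 0 by []; rewrite free_res_diffE.
- move=> s s0; have [t tE] := tmap_surj (@aug_surj R (syzygy M i.+1)) s.
  exists t => //; suff t0 : tmap N (free_res_diff M i) t = 0 by exact: t0.
  by rewrite free_res_diffE [tmap _ _ t]tE.
- by move=> t _ _ _ ->; exact: imsm_diff.
Qed.

Lemma Tor_tens M N :
  sqiso (allsm : Tor 0 M N -> Prop) zerosm (allsm : tensor M N -> Prop) zerosm.
Proof.
apply: (sqiso_trans _ (homology_sq _ _)); first exact: submodp_ker.
exists (fun t s => s = tmap N (aug M) t); split.
- by split=> [|a u v _ _ -> ->]; rewrite ?linear0// linearP.
- by move=> t _; exists (tmap N (aug M) t).
- by move=> s _; have [t tE] := tmap_surj (@aug_surj R M) s; exists t.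
- by move=> t _ _ _ ->; exact: (imsm_diff (i := 0)).
Qed.

(** In positive degree the syzygies are moved one by one from [M] to [N], and the Tor_1 that remains
    is symmetric. *)
Lemma Tor_sym M N i :
  sqiso (allsm : Tor i M N -> Prop) zerosm (allsm : Tor i N M -> Prop) zerosm.
Proof.
case: i => [|i].
  apply: (sqiso_trans _ (Tor_tens M N)) => //.
  apply: sqiso_trans (sqiso_sym (Tor_tens N M)) => //.
  exists (fun t s => s = tswap _ _ t); split.
  - by split=> [|a u v _ _ -> ->]; rewrite ?linear0// linearP.
  - by move=> t _; exists (tswap _ _ t).
  - by move=> s _; exists (tswap _ _ s); rewrite ?tswapK.
  - move=> t _ _ _ ->; split=> [->|E]; first exact: linear0.
    by rewrite /zerosm -[t]tswapK E linear0.
apply: (sqiso_trans _ (Tor_tau M N i)); first exact: submodp_tau.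
apply: sqiso_trans (sqiso_sym (Tor_tau N M i)); first exact: submodp_tau.
apply: sqiso_trans (tau_sym _ _); first exact: submodp_tau.
by have := tau_shiftn M N i 0; rewrite addn0.
Qed.

Lemma tens_kill M N y (t : tensor M N) : (forall n : N, y *: n = 0) -> y *: t = 0.
Proof.
move=> y0; move: t; apply: tens_ind => [|m n]; last by rewrite -tensZr y0 tens0r.
split=> [|a u v Eu Ev]; first by rewrite scaler0.
by rewrite scalerDr scalerA mulrC -scalerA Eu Ev scaler0 addr0.
Qed.

(** What kills the second argument kills the tensor products and so their subquotients; symmetry
    then brings [M] to the second place. *)
Lemma Tor_kill M N y i (t : Tor i M N) : (forall m : M, y *: m = 0) -> y *: t = 0.
Proof.
move=> y0.
have kr (N' : lmodType R) j (s : Tor j N' M) : y *: s = 0.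
  case: j s => [|j] s.
    have K := sqiso_kill (y := y) submodp_all submodp_all (sqiso_sym (Tor_tens N' M)).
    by apply: (K _ s I) => u _; exact: tens_kill.
  have K := sqiso_kill (y := y) (@submodp_tau _ _) submodp_all (sqiso_sym (Tor_tau N' M j)).
  by apply: (K _ s I) => u _; exact: tens_kill.
have K := sqiso_kill (y := y) submodp_all submodp_all (Tor_sym N M i).
by apply: (K _ t I) => u _; exact: kr.
Qed.

End TorSymmetry.

(** * Complexes modulo a filtration by ideals *)

Section Ideals.
Variable R : comNzRingType.
Implicit Types (a b : R^o -> Prop) (s : seq R).

Definition adj a (y : R) : R^o -> Prop := fun x => exists u r, a u /\ x = u + y * r.

Definition idl a s := foldl adj a s.

Definition nzdiv a (y : R) := forall r, a (y * r) -> a r.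

(** Weak regularity: a nonzero final quotient is not part of it, so that the notion splits along
    concatenations. *)
Fixpoint wreg a s : Prop :=
  if s is y :: s' then nzdiv a y /\ wreg (adj a y) s' else True.

Lemma submodp_adj a y : submodp a -> submodp (adj a y).
Proof.
move=> [a0 sa]; split; first by exists 0, 0; rewrite mulr0 addr0.
move=> c _ _ [u [r [au ->]]] [v [t [av ->]]]; exists (c *: u + v), (c * r + t).
by split; [exact: sa|rewrite /GRing.scale /=; ring].
Qed.

Lemma submodp_idl a s : submodp a -> submodp (idl a s).
Proof. by elim: s a => [//|y s IH] a sa /=; apply: IH; exact: submodp_adj. Qed.

Lemma sub_adj a y : subp a (adj a y).
Proof. by move=> x ax; exists x, 0; rewrite mulr0 addr0. Qed.

Lemma adj_mem a y : submodp a -> adj a y y.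
Proof. by move=> [a0 _]; exists 0, 1; rewrite mulr1 add0r. Qed.

Lemma sub_idl a s : subp a (idl a s).
Proof.
elim: s a => [|y s IH] a x ax //=; apply: IH; exact: sub_adj.
Qed.

Lemma idl_mem a s y : submodp a -> y \in s -> idl a s y.
Proof.
elim: s a => [//|z s IH] a sa; rewrite inE => /orP[/eqP ->|ys] /=.
  by apply: sub_idl; exact: adj_mem.
by apply: IH => //; exact: submodp_adj.
Qed.

Lemma adj_sub a b y : submodp b -> subp a b -> b y -> subp (adj a y) b.
Proof.
move=> sb ab bY _ [u [r [au ->]]]; apply: submodpD => //; first exact: ab.
by rewrite mulrC; exact: (submodpZ r sb bY).
Qed.

Lemma idl_sub a b s : submodp b -> subp a b -> (forall y, y \in s -> b y) ->
  subp (idl a s) b.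
Proof.
move=> sb; elim: s a => [|y s IH] a ab sub //=; apply: IH.
  by apply: adj_sub => //; apply: sub; exact: mem_head.
by move=> z zs; apply: sub; rewrite inE zs orbT.
Qed.

Lemma idl_mono a b s : subp a b -> subp (idl a s) (idl b s).
Proof.
elim: s a b => [|y s IH] a b ab //=; apply: IH => _ [u [r [au ->]]].
by exists u, r; split=> //; exact: ab.
Qed.

Lemma wreg_cat a s t : wreg a (s ++ t) <-> wreg a s /\ wreg (idl a s) t.
Proof.
elim: s a => [|y s IH] a /=; first by split=> [|[]].
by split=> [[ny /IH [ws wt]]|[[ny ws] wt]]; split=> //; apply/IH.
Qed.

Lemma idl_cat a s t : idl a (s ++ t) = idl (idl a s) t.
Proof. exact: foldl_cat. Qed.

End Ideals.

Section Complex.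
Variables (R : comNzRingType) (P : nat -> lmodType R).
Variable d : forall i, {linear P i.+1 -> P i}.
Hypothesis dd : forall i x, d i (d i.+1 x) = 0.
Implicit Types (Q : forall i, P i -> Prop) (y : R).

(** [cyc] and [bnd] are the preimages in P of the cycles and boundaries of P/Q; in degree 0
    everything is a cycle. *)
Definition cyc Q i : P i -> Prop :=
  if i is j.+1 then fun p => Q j (d j p) else allsm.

Definition bnd Q i (p : P i) : Prop := exists q r, Q i r /\ p = d i q + r.

Arguments cyc Q i p : clear implicits.
Arguments bnd Q i p : clear implicits.

Definition subcplx Q :=
  (forall i, submodp (Q i)) /\ forall i p, Q i.+1 p -> Q i (d i p).

Definition addy Q y i (p : P i) := exists q r, Q i q /\ p = q + y *: r.

Arguments addy Q y i p : clear implicits.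

Definition cnzdiv Q y := forall i (p : P i), Q i (y *: p) -> Q i p.

Lemma submodp_cyc Q i : subcplx Q -> submodp (cyc Q i).
Proof.
move=> [sQ _]; case: i => //= i; split; first by rewrite linear0; case: (sQ i).
by move=> a u v; rewrite linearP; case: (sQ i) => _; exact.
Qed.

Lemma submodp_bnd Q i : subcplx Q -> submodp (bnd Q i).
Proof.
move=> [sQ _]; split; first by exists 0, 0; rewrite linear0 addr0; split=> //; case: (sQ i).
move=> a _ _ [q [r [Qr ->]]] [q' [r' [Qr' ->]]]; exists (a *: q + q'), (a *: r + r').
by split; [apply (sQ i)|rewrite linearP scalerDr addrACA].
Qed.

Lemma bnd_cyc Q i : subcplx Q -> subp (bnd Q i) (cyc Q i).
Proof.
move=> [sQ dQ]; case: i => [//|i] _ [q [r [Qr ->]]] /=.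
by rewrite linearD dd add0r; exact: dQ.
Qed.

Lemma subcplx_addy Q y : subcplx Q -> subcplx (addy Q y).
Proof.
move=> [sQ dQ]; split=> i.
  split; first by exists 0, 0; rewrite scaler0 addr0; split=> //; case: (sQ i).
  move=> a _ _ [q [r [Qq ->]]] [q' [r' [Qq' ->]]]; exists (a *: q + q'), (a *: r + r').
  split; first by apply (sQ i).
  by rewrite !scalerDr !scalerA [y * a]mulrC addrACA.
by move=> _ [q [r [Qq ->]]]; exists (d i q), (d i r); rewrite linearD linearZ; split=> //; exact: dQ.
Qed.

(* The intermediate step of the filtration of H(P/(Q+yP)): cycles that lift to
   cycles modulo Q. *)
Definition liftcyc Q y i (p : P i) := exists z r, cyc Q i z /\ p = z + y *: r.

Arguments liftcyc Q y i p : clear implicits.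

Lemma submodp_liftcyc Q y i : subcplx Q -> submodp (liftcyc Q y i).
Proof.
move=> cQ; have [c0 sc] := submodp_cyc i cQ.
split; first by exists 0, 0; rewrite scaler0 addr0.
move=> a _ _ [q [r [Qq ->]]] [q' [r' [Qq' ->]]]; exists (a *: q + q'), (a *: r + r').
split; first exact: sc.
by rewrite !scalerDr !scalerA [y * a]mulrC addrACA.
Qed.

Lemma bnd_liftcyc Q y i : subcplx Q -> subp (bnd (addy Q y) i) (liftcyc Q y i).
Proof.
move=> cQ _ [q [_ [[r [t [Qr ->]]] ->]]]; exists (d i q + r), t; rewrite addrA; split=> //.
by apply: bnd_cyc => //; exists q, r.
Qed.

Lemma liftcyc_cyc Q y i : subcplx Q -> subp (liftcyc Q y i) (cyc (addy Q y) i).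
Proof.
case: i => [//|i] cQ _ [z [r [/= Qz ->]]]; exists (d i z), (d i r).
by rewrite linearD linearZ.
Qed.

(** The correspondence is the projection P/Q -> P/(Q + yP) on homology, whose kernel is the image of
    multiplication by y. *)
Lemma step_coker Q y i : subcplx Q -> cnzdiv Q y ->
  sqiso (cyc Q i) (imy y (cyc Q i) (bnd Q i)) (liftcyc Q y i) (bnd (addy Q y) i).
Proof.
move=> cQ ny; have [sQ dQ] := cQ.
exists (fun z p => exists r, p = z + y *: r); split.
- split; first by exists 0; rewrite scaler0 addr0.
  move=> a u v _ _ [r ->] [t ->]; exists (a *: r + t).
  by rewrite !scalerDr !scalerA [y * a]mulrC addrACA.
- move=> z cz; exists z; last by exists 0; rewrite scaler0 addr0.
  by exists z, 0; rewrite scaler0 addr0.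
- by move=> _ [z [r [cz ->]]]; exists z => //; exists r.
- move=> z p cz lp [r pE]; split=> [[u [_ [cu [q [s [Qs ->]]] zE]]]|].
    exists q, (s + y *: (u + r)); split; first by exists s, (u + r).
    by rewrite pE zE scalerDr !addrA.
  move=> [q [_ [[s [t [Qs ->]]] pE']]].
  have zE : z = (d i q + s) + y *: (t - r).
    by rewrite scalerBr addrA -(addrA (d i q)) -pE' pE addrK.
  exists (t - r), (d i q + s); split=> //; last by exists q, s.
  case: i z p cz lp r pE q s t Qs pE' zE => [//|i] z p cz lp r pE q s t Qs pE' zE /=.
  (* The multiplier [t - r] is itself a cycle modulo Q: y times its differential lies in Q, and y
     can be cancelled. *)
  apply: ny; rewrite -linearZ.
  have -> : y *: (t - r) = z - (d i.+1 q + s) by rewrite zE [RHS]addrC addKr.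
  rewrite linearB linearD dd add0r; apply: submodpB; [exact: sQ|exact: cz|exact: dQ].
Qed.

(* The connecting map sends p, with d p = q + y w and q in Q, to w. *)
Lemma step_ker Q y i : subcplx Q -> cnzdiv Q y ->
  sqiso (cyc (addy Q y) i.+1) (liftcyc Q y i.+1) (kery y (cyc Q i) (bnd Q i)) (bnd Q i).
Proof.
move=> cQ ny; have [sQ dQ] := cQ.
exists (fun p w => Q i (d i p - y *: w)); split.
- split; first by rewrite linear0 scaler0 subr0; case: (sQ i).
  move=> a u v u' v' Qu Qv; have [_ /(_ a _ _ Qu Qv)] := sQ i.
  rewrite linearP !scalerDr scalerN !scalerA [y * a]mulrC.
  by congr Q; rewrite opprD addrACA.
- move=> p [q [w [Qq pE]]]; exists w; last by rewrite pE addrK.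
  split; last by exists p, (- q); rewrite pE addrC addKr; split=> //; exact: submodpN.
  case: i p q w Qq pE => [//|i] p q w Qq pE /=; apply: ny; rewrite -linearZ.
  have -> : y *: w = d i.+1 p - q by rewrite pE addrC addKr.
  by rewrite linearB dd sub0r; apply: submodpN => //; exact: dQ.
- move=> w [cw [q [r [Qr wE]]]]; exists q.
    exists (- r), w; rewrite wE addrC addrK; split=> //; exact: submodpN.
  by rewrite wE opprD addNKr; apply: submodpN.
- move=> p w cp [cw _] Qpw; split=> [[z [r [/= Qz pE]]]|[q [r [Qr wE]]]].
    have Qr : Q i (w - d i r).
      apply: ny; rewrite scalerBr.
      have -> : y *: w - y *: d i r = d i z - (d i p - y *: w).
        have -> : d i p = d i z + y *: d i r by rewrite pE linearD linearZ.
        by rewrite opprB addrCA; congr (_ + _); rewrite opprD addrA subrr add0r.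
      by apply: submodpB.
    by exists r, (w - d i r); rewrite [RHS]addrC subrK.
  exists (p - y *: q), q; rewrite subrK; split=> //=.
  rewrite linearB linearZ.
  have -> : d i p - y *: d i q = (d i p - y *: w) + y *: r.
    by rewrite wE scalerDr opprD addrA addrNK.
  by apply: submodpD => //; exact: submodpZ.
Qed.

Lemma addy_flenS Q y i c e : subcplx Q -> cnzdiv Q y ->
  flen (imy y (cyc Q i.+1) (bnd Q i.+1)) (cyc Q i.+1) c ->
  flen (bnd Q i) (kery y (cyc Q i) (bnd Q i)) e ->
  flen (bnd (addy Q y) i.+1) (cyc (addy Q y) i.+1) (c + e).
Proof.
move=> cQ ny hc he; have cQ' := subcplx_addy y cQ.
have sc j := submodp_cyc j cQ; have sb j := submodp_bnd j cQ.
apply: (@flen_add _ _ _ (liftcyc Q y i.+1)).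
- exact: submodp_bnd.
- exact: submodp_liftcyc.
- exact: submodp_cyc.
- apply: (sqiso_flen _ _ _ _ _ _ (step_coker _ cQ ny) hc) => //.
  + exact: submodp_imy.
  + exact: submodp_liftcyc.
  + exact: submodp_bnd.
  + by apply: imy_sub => //; exact: bnd_cyc.
  + exact: bnd_liftcyc.
- apply: (sqiso_flen _ _ _ _ _ _ (sqiso_sym (step_ker _ cQ ny)) he) => //.
  + exact: submodp_kery.
  + exact: submodp_cyc.
  + exact: submodp_liftcyc.
  + by apply: sub_kery => //; exact: bnd_cyc.
  + exact: liftcyc_cyc.
Qed.

(** In degree 0 every element lifts to a cycle, so the kernel term is absent. *)
Lemma addy_flen0 Q y c : subcplx Q -> cnzdiv Q y ->
  flen (imy y (cyc Q 0) (bnd Q 0)) (cyc Q 0) c ->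
  flen (bnd (addy Q y) 0) (cyc (addy Q y) 0) c.
Proof.
move=> cQ ny hc; have cQ' := subcplx_addy y cQ.
have sc j := submodp_cyc j cQ; have sb j := submodp_bnd j cQ.
have h : flen (bnd (addy Q y) 0) (liftcyc Q y 0) c.
  apply: (sqiso_flen _ _ _ _ _ _ (step_coker _ cQ ny) hc) => //.
  + exact: submodp_imy.
  + exact: submodp_liftcyc.
  + exact: submodp_bnd.
  + exact: bnd_liftcyc.
apply: flen_eq h => // p; split=> // _.
by exists p, 0; rewrite scaler0 addr0.
Qed.

Definition vanish Q i := subp (cyc Q i) (bnd Q i).

Lemma flen_vanish Q i : subcplx Q -> vanish Q i -> flen (bnd Q i) (cyc Q i) 0.
Proof. by move=> cQ v; apply: flen0 => //; exact: bnd_cyc. Qed.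

Lemma addy_vanish Q y i : subcplx Q -> cnzdiv Q y -> vanish Q i.+1 ->
  subp (kery y (cyc Q i) (bnd Q i)) (bnd Q i) -> vanish (addy Q y) i.+1.
Proof.
move=> cQ ny v k; have sb := submodp_bnd i cQ.
have h1 : flen (imy y (cyc Q i.+1) (bnd Q i.+1)) (cyc Q i.+1) 0.
  apply: flen0; first by apply: imy_sub; [exact: submodp_cyc|exact: bnd_cyc].
  by move=> p /v; apply: sub_imy; exact: submodp_cyc.
have h2 : flen (bnd Q i) (kery y (cyc Q i) (bnd Q i)) 0.
  by apply: flen0 => //; apply: sub_kery => //; exact: bnd_cyc.
apply: flen0_sub (addy_flenS cQ ny h1 h2).
by apply: submodp_bnd; exact: subcplx_addy.
Qed.

Definition kills y Q := forall i (p : P i), cyc Q i p -> bnd Q i (y *: p).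

Lemma kills_imy y Q i p : subcplx Q -> kills y Q ->
  imy y (cyc Q i) (bnd Q i) p <-> bnd Q i p.
Proof.
move=> cQ k; have sb := submodp_bnd i cQ; split; last by apply: sub_imy; exact: submodp_cyc.
by move=> [u [v [cu bv ->]]]; apply: submodpD => //; exact: k.
Qed.

Lemma kills_kery y Q i p : kills y Q ->
  kery y (cyc Q i) (bnd Q i) p <-> cyc Q i p.
Proof. by move=> k; split=> [[]//|cp]; split=> //; exact: k. Qed.

Lemma addy_kill Q y c L : subcplx Q -> cnzdiv Q y -> kills y Q ->
  (forall i, flen (bnd Q i) (cyc Q i) ('C(c, i) * L)) ->
  forall i, flen (bnd (addy Q y) i) (cyc (addy Q y) i) ('C(c.+1, i) * L).
Proof.
move=> cQ ny k h.
have h1 i : flen (imy y (cyc Q i) (bnd Q i)) (cyc Q i) ('C(c, i) * L).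
  by apply: flen_eq (h i) => // p; split=> /(kills_imy _ cQ k).
have h2 i : flen (bnd Q i) (kery y (cyc Q i) (bnd Q i)) ('C(c, i) * L).
  by apply: flen_eq (h i) => // p; split=> /(kills_kery _ k).
case=> [|i]; first by have := addy_flen0 cQ ny (h1 0%N); rewrite !bin0.
by rewrite binS mulnDl; exact: addy_flenS.
Qed.

(** When y kills homology, the kernel term is all of H_i(P/Q), which is thus a quotient of
    H_(i+1)(P/(Q + yP)). Concretely, y p is d q modulo Q, so q is a cycle modulo Q + yP; writing q
    as a boundary there and cancelling y shows that p bounds. *)
Lemma kill_vanish_prev Q y i : subcplx Q -> cnzdiv Q y -> kills y Q ->
  vanish (addy Q y) i.+1 -> vanish Q i.
Proof.
move=> cQ ny k v p cp; have [q [r [Qr E]]] := k _ _ cp; have [sQ dQ] := cQ.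
have [|s [_ [[t [u [Qt ->]]] qE]]] := v q.
  exists (- r), p; rewrite E addrC addrK; split=> //; exact: submodpN.
exists u, (p - d i u); rewrite [RHS]addrC subrK; split=> //; apply: ny.
have -> : y *: (p - d i u) = d i t + r.
  rewrite scalerBr E qE !linearD dd add0r linearZ /= addrAC addrK.
  by [].
by apply: submodpD => //; exact: dQ.
Qed.

End Complex.
Arguments cyc {R P} d Q i p.
Arguments bnd {R P} d Q i p.
Arguments addy {R P} Q y i p.
Arguments liftcyc {R P} d Q y i p.
Arguments vanish {R P} d Q i.

Section CoefficientSystem.
Variables (R : comNzRingType) (P : nat -> lmodType R).
Variable d : forall i, {linear P i.+1 -> P i}.
Hypothesis dd : forall i x, d i (d i.+1 x) = 0.

(* [E a] plays the role of the subcomplex aP of a complex of free modules. *)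
Definition coefsys (E : (R^o -> Prop) -> forall i, P i -> Prop) :=
  [/\ forall a, submodp a -> subcplx d (E a),
      forall a y, submodp a -> E (adj a y) = addy (E a) y
    & forall a y, submodp a -> nzdiv a y -> cnzdiv (E a) y].

Variable E : (R^o -> Prop) -> forall i, P i -> Prop.
Hypothesis cE : coefsys E.
Implicit Types (a b : R^o -> Prop) (s : seq R).

Let sE a : submodp a -> subcplx d (E a). Proof. by case: cE => + _ _; exact. Qed.
Let aE a y : submodp a -> E (adj a y) = addy (E a) y.
Proof. by case: cE => _ + _; exact. Qed.
Let nE a y : submodp a -> nzdiv a y -> cnzdiv (E a) y.
Proof. by case: cE => _ _; exact. Qed.

Lemma idl_kill a s c L : submodp a -> wreg a s ->
  (forall b y, submodp b -> y \in s -> kills d y (E b)) ->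
  (forall i, flen (bnd d (E a) i) (cyc d (E a) i) ('C(c, i) * L)) ->
  forall i, flen (bnd d (E (idl a s)) i) (cyc d (E (idl a s)) i) ('C(c + size s, i) * L).
Proof.
elim: s a c => [|y s IH] a c sa /=; first by rewrite addn0.
move=> [ny ws] k h; rewrite addnS -addSn; apply: IH => //.
- exact: submodp_adj.
- by move=> b z sb zs; apply: k => //; rewrite inE zs orbT.
- rewrite aE//; apply: (addy_kill dd) => //; [exact: sE|exact: nE|].
  by apply: k => //; exact: mem_head.
Qed.

Lemma idl_vanish a s c : submodp a -> wreg a s ->
  (forall i, (c < i)%N -> vanish d (E a) i) ->
  forall i, (c + size s < i)%N -> vanish d (E (idl a s)) i.
Proof.
elim: s a c => [|y s IH] a c sa /=; first by rewrite addn0.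
move=> [ny ws] v; rewrite addnS -addSn; apply: IH => //; first exact: submodp_adj.
case=> // i; rewrite ltnS aE// => ci; apply: (addy_vanish dd) => //.
- exact: sE.
- exact: nE.
- by apply: v; exact: leqW.
- by move=> p [cp _]; exact: v.
Qed.

(** Here vanishing descends from the larger ideal to [a], and the bound drops by one for each member
    of [s] removed. *)
Lemma vanish_idl a s c : submodp a -> wreg a s ->
  (forall b y, submodp b -> y \in s -> kills d y (E b)) ->
  (forall i, (c + size s < i)%N -> vanish d (E (idl a s)) i) ->
  forall i, (c < i)%N -> vanish d (E a) i.
Proof.
elim: s a c => [|y s IH] a c sa /=; first by rewrite addn0.
move=> [ny ws] k v i ci.
have kb b z : submodp b -> z \in s -> kills d z (E b).
  by move=> sb zs; apply: k => //; rewrite inE zs orbT.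
have v' := IH (adj a y) c.+1 (submodp_adj y sa) ws kb.
apply: (kill_vanish_prev dd (y := y)); [exact: sE|exact: nE|by apply: k; rewrite ?mem_head|].
by rewrite -aE//; apply: v' => // j; rewrite addSnnS; exact: v.
Qed.

End CoefficientSystem.

(** * Free resolutions with coefficients in an ideal *)

Section FreeCoefficients.
Variable R : comNzRingType.
Implicit Types (a : R^o -> Prop) (M S : lmodType R).

(** The submodule aF of a free module F, given by coefficients so that a nonzerodivisor modulo [a]
    is at once one on F/aF. *)
Definition coefin a S (D : free_on S) : Prop := forall k, a (coeff k D).

Lemma submodp_coefin a S : submodp a -> submodp (@coefin a S).
Proof.
move=> sa; split=> [k|c u v hu hv k]; first by rewrite coeff0; case: sa.
by rewrite coeffD coeffZ; apply sa.
Qed.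

Lemma coefinZ a S c (D : free_on S) : submodp a -> a c -> coefin a (c *: D).
Proof. by move=> sa ac k; rewrite coeffZ mulrC; exact: (submodpZ _ sa ac). Qed.

Lemma coefin_map a S S' (f : {linear free_on S -> free_on S'}) D :
  submodp a -> coefin a D -> coefin a (f D).
Proof.
move=> sa aD; rewrite (freeg_sum_sup (uniq_dom D) (fun x => id)) linear_sum.
apply: submodp_sum; first exact: submodp_coefin.
by move=> k; rewrite linearZ; apply: coefinZ.
Qed.

Lemma coefin_adj a y S (D : free_on S) : submodp a ->
  coefin (adj a y) D <-> exists q r, coefin a q /\ D = q + y *: r.
Proof.
move=> sa; split=> [aD|[q [r [aq ->]]] k]; last first.
  by exists (coeff k q), (coeff k r); rewrite coeffD coeffZ; split=> //; exact: aq.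
have /choice[r rE] k : exists r, a (coeff k D - y * r).
  by have [u [r [au ->]]] := aD k; exists r; rewrite addrK.
(* The chosen [r] may have infinite support, so it is cut down to the support of [D]. *)
pose D' : free_on S := \sum_(k <- dom D) r k *: << k >>.
have D'E k : coeff k D' = if k \in dom D then r k else 0.
  rewrite raddf_sum /=; have E z : coeff k (r z *: << z >> : free_on S) = r z * (z == k)%:R.
    by rewrite coeffZ coeffU mul1r.
  under eq_bigr do rewrite E.
  case: ifP => [kD|/negP kD].
    rewrite (bigD1_seq k) ?uniq_dom//= eqxx mulr1 big1 ?addr0// => z.
    by move=> /negPf ->; rewrite mulr0.
  rewrite big_seq big1// => z zD; have -> : (z == k) = false.
    by apply/negP => /eqP zk; apply: kD; rewrite -zk.
  by rewrite mulr0.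
exists (D - y *: D'), D'; rewrite subrK; split=> // k.
rewrite coeffB coeffZ D'E; case: ifP => [_|/negbT /coeff_outdom ->]; first exact: rE.
by rewrite mulr0 subr0; case: sa.
Qed.

Variable M : lmodType R.

Lemma free_res_dd i x : free_res_diff M i (free_res_diff M i.+1 x) = 0.
Proof. by apply/free_res_exact; exists x. Qed.

Definition coefres a i : free_res M i -> Prop := @coefin a (syzygy M i).
Arguments coefres a i p : clear implicits.

Lemma coefres_sys : coefsys (free_res_diff M) coefres.
Proof.
split=> [a sa|a y sa|a y sa ny i p ap k].
- by split=> [i|i p]; [exact: submodp_coefin|exact: (coefin_map (free_res_diff M i))].
- apply: functional_extensionality_dep => i; apply/funext => p; apply/propext.
  exact: coefin_adj.
- by apply: ny; rewrite -coeffZ; exact: ap.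
Qed.

Lemma coefres0_vanish i : (0 < i)%N -> vanish (free_res_diff M) (coefres (@zerosm R R^o)) i.
Proof.
have z0 j p : coefres zerosm j p -> p = 0.
  by move=> zp; apply/eqP/freeg_eqP => k; rewrite coeff0; exact: zp.
case: i => // i _ p /= /z0 /free_res_exact[q <-]; exists q, 0; rewrite addr0; split=> //.
exact: submodp0 (submodp_coefin _ submodp_zero).
Qed.

Variable N : submodClosed R^o.
Let a : R^o -> Prop := fun r => r \in N.

Let one : qmod N := \pi_(qmod N) (1 : R^o).

Lemma qmod_one (n : qmod N) : exists r : R, n = r *: one.
Proof.
exists (repr n : R^o); rewrite -[LHS]reprK /one -linearZ.
by congr \pi; rewrite /GRing.scale /= mulr1.
Qed.

Lemma qmod_oneZ (r : R) : r *: one = 0 <-> a r.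
Proof.
rewrite /one -linearZ [_ *: _]mulr1.
split=> [e|ar].
  have : (r : R^o) - 0 \in N by apply/qmod_eqP; rewrite e raddf0.
  by rewrite subr0.
have /qmod_eqP e : (r : R^o) - 0 \in N by rewrite subr0.
by rewrite [LHS]e raddf0.
Qed.

Lemma tens_one S (t : tensor (free_on S) (qmod N)) : exists p, t = tens p one.
Proof.
move: t; apply: tens_ind => [|m n]; first split.
- by exists 0; rewrite tens0l.
- by move=> c _ _ [p ->] [q ->]; exists (c *: p + q); rewrite tensDl tensZl.
- by have [r ->] := qmod_one n; exists (r *: m); rewrite tensZl tensZr.
Qed.

Lemma tens_one0 S (p : free_on S) : tens p one = 0 <-> coefin a p.
Proof.
split=> [e k|ap].
  by apply/qmod_oneZ; rewrite -tcoef_tens e linear0.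
by apply: tcoef_eq0 => k; rewrite tcoef_tens; apply/qmod_oneZ; exact: ap.
Qed.

Lemma bnd_imsm i (p : free_res M i) :
  imsm (tmap (qmod N) (free_res_diff M i)) (tens p one) <->
  bnd (free_res_diff M) (coefres a) i p.
Proof.
split=> [[t]|[q [r [ar ->]]]].
  have [q ->] := tens_one t; rewrite tmap_tens => e.
  exists q, (p - free_res_diff M i q); rewrite [RHS]addrC subrK; split=> //.
  by apply/tens_one0; rewrite -scaleN1r tensDl tensZl scaleN1r e subrr.
exists (tens q one); rewrite tmap_tens tensDl.
by move/tens_one0: ar => ->; rewrite addr0.
Qed.

(** The map sending p to p (x) 1 identifies P/NP with P (x) R/N. *)
Lemma Tor_coefres i :
  sqiso (allsm : Tor i M (qmod N) -> Prop) zerosm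
        (cyc (free_res_diff M) (coefres a) i) (bnd (free_res_diff M) (coefres a) i).
Proof.
case: i => [|i]; apply: (sqiso_trans _ (homology_sq _ _)); try exact: submodp_ker.
all: exists (fun t p => t = tens p one); split.
all: try by split=> [|c u v u' v' -> ->]; rewrite ?tens0l// tensDl tensZl.
- by move=> t _; have [p ->] := tens_one t; exists p.
- by move=> p _; exists (tens p one).
- by move=> _ p _ _ ->; exact: bnd_imsm.
- move=> t t0; have [p pE] := tens_one t; exists p => //=.
  have : tmap (qmod N) (free_res_diff M i) t = 0 by [].
  by rewrite pE tmap_tens => /tens_one0.
- move=> p cp; exists (tens p one) => //.
  suff e : tmap (qmod N) (free_res_diff M i) (tens p one) = 0 by exact: e.
  by rewrite tmap_tens; apply/tens_one0.
- by move=> _ p _ _ ->; exact: bnd_imsm.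
Qed.

Lemma submodp_coefsys_cyc i : submodp (cyc (free_res_diff M) (coefres a) i).
Proof. by apply: submodp_cyc; case: coefres_sys => + _ _; apply; exact: submodp_mem. Qed.

Lemma submodp_coefsys_bnd i : submodp (bnd (free_res_diff M) (coefres a) i).
Proof. by apply: submodp_bnd; case: coefres_sys => + _ _; apply; exact: submodp_mem. Qed.

Lemma flen_Tor i r :
  flen (bnd (free_res_diff M) (coefres a) i) (cyc (free_res_diff M) (coefres a) i) r ->
  flen (zerosm : Tor i M (qmod N) -> Prop) allsm r.
Proof.
move=> h; have sc := submodp_coefsys_cyc i; have sb := submodp_coefsys_bnd i.
apply: (sqiso_flen sc sb submodp_all submodp_zero (flen_sub h) _ (sqiso_sym (Tor_coefres i)) h).
by [].
Qed.

Lemma coefres_kills y : (forall m : M, y *: m = 0) -> kills (free_res_diff M) y (coefres a).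
Proof.
move=> y0 i p cp; have sc := submodp_coefsys_cyc i.
have K := sqiso_kill (y := y) submodp_all sc (Tor_coefres i).
by apply: K cp => u _; exact: Tor_kill.
Qed.

End FreeCoefficients.
Arguments coefres {R} M a i p.

(** * Noetherian local rings *)

Section Generators.
Variable R : comNzRingType.
Implicit Types (a b : R^o -> Prop) (s : seq R).

Lemma ideal_genE s (x : R^o) : x \in ideal_gen s <-> idl zerosm s x.
Proof.
split=> [/asboolP[t ts ->]|].
  apply: submodp_sum_seq => [|p /ts ps]; first exact: submodp_idl submodp_zero.
  by apply: submodpZ; [exact: submodp_idl submodp_zero|exact: idl_mem submodp_zero ps].
apply: (@idl_sub _ _ (fun x => x \in ideal_gen s)).
- exact: submodp_mem.
- by move=> _ ->; exact: rpred0.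
- move=> y ys; apply/asboolP; exists [:: (1, y)]; last by rewrite big_seq1 scale1r.
  by move=> p; rewrite inE => /eqP ->.
Qed.

Lemma adjC a x y : adj (adj a x) y = adj (adj a y) x.
Proof.
have sub b v w z : adj (adj b v) w z -> adj (adj b w) v z.
  move=> [_ [r [[u [t [bu ->]]] ->]]]; exists (u + w * r), t.
  by rewrite addrAC; split=> //; exists u, r.
by apply/funext => z; apply/propext; split; exact: sub.
Qed.

Lemma nzdivX a y r t : nzdiv a y -> a (r * y ^+ t) -> a r.
Proof.
move=> ny; elim: t => [|t IH]; first by rewrite mulr1.
by rewrite exprS mulrCA => /ny.
Qed.

Definition primep (p : R^o -> Prop) := [/\ submodp p, ~ p 1
  & forall x y : R, p (x * y) -> p x \/ p y].

Fixpoint pchain n p : Prop :=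
  primep p /\ if n is n'.+1 then exists q, pchain n' q /\ ssubp q p else True.

Lemma pchain_has_chain n p : pchain n p -> exists N : nat -> submodClosed R^o,
  [/\ forall i, (i <= n)%N -> prime_id (N i),
      forall i, (i < n)%N -> {subset N i <= N i.+1} /\ ~ (N i =i N i.+1)
    & forall v, (v \in N n) <-> p v].
Proof.
have pr q : primep q -> prime_id (Defs.span q : submodClosed R^o).
  move=> [sq q1 qM]; split; first by apply/negP; rewrite in_span.
  by move=> x y /(in_span _ sq)/qM[] h; [left|right]; apply/(in_span _ sq).
elim: n p => [|n IH] p /= [pp].
  move=> _; exists (fun=> Defs.span p : submodClosed R^o).
  by split=> // [i _|v]; [exact: pr|case: pp => sp _ _; rewrite in_span].
have [sp _ _] := pp; move=> [q [/IH [N [pN sN Nq]] [qp [v pv nqv]]]].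
exists (fun i => if (i <= n)%N then N i else (Defs.span p : submodClosed R^o)); split.
- by move=> i _; case: ifP => [/pN//|_]; exact: pr.
- move=> i; rewrite ltnS => ir; rewrite ir; case: (ltngtP i n) ir => // [ir _|->] //; first exact: sN.
  move=> _; split=> [w /Nq /qp|e]; first by rewrite in_span.
  by apply: nqv; apply/Nq; rewrite e in_span.
- by move=> w; rewrite ltnn in_span.
Qed.

Lemma krull_dim_pchain n p t : krull_dim R = n%:Z%:E -> pchain t p -> (t <= n)%N.
Proof.
rewrite /krull_dim /chain_height; case: pselect => // ex.
case: (cid ex) => /= r [_ mr] [<-] /pchain_has_chain[N [pN sN _]].
by apply: mr; exists N.
Qed.

End Generators.

Section Noetherian.
Variable R : comNzRingType.
Hypothesis noethR : noetherian R.
Implicit Types (a b : R^o -> Prop) (s : seq R).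

(** Otherwise choice yields a strictly increasing sequence in [F]; its union is finitely generated,
    hence already equal to some member. *)
Lemma noeth_max (F : (R^o -> Prop) -> Prop) : (forall a, F a -> submodp a) ->
  (exists a, F a) -> exists a, F a /\ forall b, F b -> subp a b -> subp b a.
Proof.
move=> Fs [a0 Fa0]; apply: contrapT => no.
have ex (a : {a | F a}) : exists b : {b | F b}, subp (sval a) (sval b) /\
    ~ subp (sval b) (sval a).
  apply: contrapT => nb; apply: no; exists (sval a); split; first exact: svalP.
  move=> b Fb ab; apply: contrapT => ba; apply: nb; by exists (exist _ b Fb).
have [next nextP] := choice ex.
pose c n := sval (iter n next (exist _ a0 Fa0)).
have cF n : F (c n) by exact: svalP.
have cS n : subp (c n) (c n.+1) by case: (nextP (iter n next (exist _ a0 Fa0))).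
have cM n k : subp (c n) (c (k + n)%N).
  by elim: k => [//|k IH] x /IH; exact: cS.
pose U x := exists n, c n x.
have sU : submodp U.
  split; first by exists 0%N; case: (Fs _ (cF 0%N)).
  move=> r u v [n cu] [k cv]; exists (k + n)%N; apply (Fs _ (cF _)); first exact: cM.
  by rewrite addnC; exact: cM.
have [s sE] := noethR (Defs.span U : submodClosed R^o).
have sg (x : R) : x \in s -> U x.
  by move=> xs; apply/(in_span _ sU); rewrite sE; apply/ideal_genE; exact: idl_mem submodp_zero xs.
have [n sn] : exists n, forall x, x \in s -> c n x.
  elim: s {sE} sg => [|x s IH] sg; first by exists 0%N.
  have [|n sn] := IH; first by move=> y ys; apply: sg; rewrite inE ys orbT.
  have [k ck] := sg x (mem_head _ _); exists (k + n)%N => y; rewrite inE => /orP[/eqP ->|ys].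
    by rewrite addnC; exact: cM ck.
  by apply: cM; exact: sn.
have [_] := nextP (iter n next (exist _ a0 Fa0)); apply => x cx.
have : x \in Defs.span U by apply/(in_span _ sU); exists n.+1.
rewrite sE => /ideal_genE; apply: idl_sub => //; first exact: Fs (cF n).
by move=> _ ->; case: (Fs _ (cF n)).
Qed.

(** An ideal maximal among those that contain [a] and miss the multiplicative set [S] is prime. *)
Lemma prime_avoiding a (S : R -> Prop) : submodp a -> S 1 ->
  (forall x y, S x -> S y -> S (x * y)) -> (forall x, S x -> ~ a x) ->
  exists q, [/\ primep q, subp a q & forall x, S x -> ~ q x].
Proof.
move=> sa S1 SM Sa.
pose F b := [/\ submodp b, subp a b & forall x, S x -> ~ b x].
have [||q [[sq aq Sq] mq]] := @noeth_max F; first by move=> b [].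
  by exists a; split.
exists q; split=> //; split=> //; first exact: Sq.
have meet x : ~ q x -> exists z u c, [/\ S z, q u & z = u + x * c].
  move=> nq; apply: contrapT => no; apply: nq; apply: mq (adj_mem x sq); last exact: sub_adj.
  split; [exact: submodp_adj|by move=> z /aq; exact: sub_adj|].
  by move=> z Sz [u [c [qu zE]]]; apply: no; exists z, u, c.
move=> x y qxy; apply: contrapT => /not_orP[/meet[s [u [c [Ss qu sE]]]] /meet[t [v [e [St qv tE]]]]].
apply: (Sq _ (SM _ _ Ss St)).
have -> : s * t = (v + y * e) * u + ((x * c) * v + (c * e) * (x * y)).
  by rewrite sE tE; ring.
have h1 := submodpZ (v + y * e) sq qu; have h2 := submodpZ (x * c) sq qv.
exact: (submodpD sq h1 (submodpD sq h2 (submodpZ (c * e) sq qxy))).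
Qed.

(** For the last term y, the products t y^i with t outside [p] miss the ideal of the earlier terms,
    since y is a nonzerodivisor modulo it. A prime over that ideal missing all these products lies
    in [p] and omits y, which adds one step to the chain. *)
Lemma wreg_pchain a s p : submodp a -> primep p -> wreg a s -> subp (idl a s) p ->
  pchain (size s) p.
Proof.
move=> sa; elim/last_ind: s p => [|s y IH] p pp; first by [].
rewrite -cats1 wreg_cat /= => -[ws [ny _]]; rewrite idl_cat /= => sp.
rewrite size_cat addn1 /=; split=> //; have [sP p1 pM] := pp.
have sb := submodp_idl s sa.
pose S z := exists t i, ~ p t /\ z = t * y ^+ i.
have [|||q [pq bq Sq]] := @prime_avoiding (idl a s) S sb.
- by exists 1, 0%N; rewrite expr0 mulr1.
- move=> _ _ [t [i [pt ->]]] [t' [i' [pt' ->]]]; exists (t * t'), (i + i')%N.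
  by split; [move/pM => []|rewrite exprD; ring].
- move=> _ [t [i [pt ->]]] /(nzdivX ny) /(sub_adj y) /sp; exact: pt.
exists q; split; first exact: IH.
split=> [x qx|]; first by apply: contrapT => px; apply: Sq qx; exists x, 0%N; rewrite expr0 mulr1.
exists y; first by apply: sp; exact: adj_mem.
by apply: Sq; exists 1, 1%N; rewrite mul1r expr1.
Qed.

Section Local.
Variable m : submodClosed R^o.
Hypothesis locR : local_ring m.

Let sm : submodp (fun x => x \in m) := submodp_mem m.

Lemma local_one : (1 : R^o) \notin m.
Proof. by case: locR => _ []. Qed.

Lemma proper_local a : submodp a -> ~ a 1 -> forall x, a x -> x \in m.
Proof.
move=> sa a1; pose F b := [/\ submodp b, subp a b & ~ b 1].
have [||q [[sq aq q1] mq]] := @noeth_max F; first by move=> b [].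
  by exists a; split.
move=> x /aq qx; have [_ _ um] := locR.
rewrite -(um (Defs.span q : submodClosed R^o)); first by rewrite in_span.
split; first by apply/negP; rewrite in_span.
move=> Q Q1 qQ z; apply/idP/idP => [/qQ//|zQ].
rewrite in_span//; apply: (mq (fun z => z \in Q)) => //.
  split; [exact: submodp_mem| |exact/negP].
  by move=> w /aq qw; apply: qQ; rewrite in_span.
by move=> w qw; apply: qQ; rewrite in_span.
Qed.

Lemma local_unit (x : R) : (x : R^o) \notin m -> exists y, y * x = 1.
Proof.
move=> xm; have [[u [r [-> /esym e]]]|n1] := pselect (adj zerosm x 1).
  by exists r; rewrite mulrC -e add0r.
case/negP: xm; apply: proper_local n1 _ (adj_mem x submodp_zero).
exact: submodp_adj submodp_zero.
Qed.

Lemma sub1_unit (x c : R) : (x : R^o) \in m -> exists y, y * (1 - x * c) = 1.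
Proof.
move=> xm; apply: local_unit; apply/negP => h; case/negP: local_one.
rewrite -[1 : R^o](subrK (x * c)); apply: (submodpD sm h).
by rewrite mulrC; exact: (submodpZ c sm xm).
Qed.

Lemma prime_local : primep (fun x => x \in m).
Proof.
split; [exact: sm|exact/negP/local_one|move=> x y xym].
have [xm|/local_unit[u ux]] := boolP ((x : R^o) \in m); first by left.
by right; rewrite -[y]mul1r -ux -mulrA; exact: (submodpZ u sm xym).
Qed.

(* Nakayama: K = (a : y) satisfies K = a + xK. *)
Lemma nzdiv_swap a x y : submodp a -> (x : R^o) \in m -> nzdiv a x ->
  nzdiv (adj a x) y -> nzdiv a y /\ nzdiv (adj a y) x.
Proof.
move=> sa xm nx ny; split; last first.
  move=> r [u [t [au e]]].
  have [v [w [av tE]]] : adj a x t.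
    by apply: ny; exists (- u), r; rewrite e addKr; split=> //; exact: submodpN.
  exists (r - y * w), w; rewrite subrK; split=> //; apply: nx.
  have -> : x * (r - y * w) = u + y * v by rewrite mulrBr e tE; ring.
  by apply: submodpD => //; exact: (submodpZ y sa av).
pose K : R^o -> Prop := fun r => a (y * r).
have sK : submodp K.
  split; first by rewrite /K mulr0; case: sa.
  move=> c u v Ku Kv; rewrite /K.
  have -> : y * (c *: u + v) = c * (y * u) + y * v by rewrite /GRing.scale /=; ring.
  by apply sa.
have aK : subp a K by move=> r ar; exact: (submodpZ y sa ar).
have KE r : K r -> exists u t, [/\ a u, K t & r = u + x * t].
  move=> Kr; have [|u [t [au rE]]] := ny r; first exact: sub_adj.
  exists u, t; split=> //; apply: nx.
  have -> : x * (y * t) = y * r - y * u by rewrite rE; ring.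
  exact: (submodpB sa Kr (submodpZ y sa au)).
move=> r0 Kr0; apply: contrapT => nar0.
(* Nakayama through maximality: [b] is maximal among the ideals between [a] and [K] other than [K],
   so that K = b + (r) for every r in [K] outside [b]. *)
pose F b := [/\ submodp b, subp a b, subp b K & exists2 r, K r & ~ b r].
have [||b [[sb ab bK [r Kr nbr]] mb]] := @noeth_max F; first by move=> b [].
  by exists a; split=> //; exists r0.
have big z : K z -> ~ b z -> subp K (adj b z).
  move=> Kz nbz w Kw; apply: contrapT => nw; apply: nbz.
  apply: mb (adj_mem z sb); last exact: sub_adj.
  split; [exact: submodp_adj|by move=> v /ab; exact: sub_adj|exact: adj_sub|by exists w].
(* Otherwise r lies in b + (x r), so r (1 - x c) is in [b] for some c, and 1 - x c is a unit. *)
have xr : b (x * r).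
  apply: contrapT => nb; have Kxr : K (x * r) by exact: (submodpZ x sK Kr).
  have [u [c [bu rE]]] := big _ Kxr nb r Kr.
  have [v vE] := sub1_unit c xm; apply: nbr.
  have -> : r = v * u.
    have -> : u = r * (1 - x * c) by rewrite mulrBr mulr1 {1}rE; ring.
    by rewrite mulrCA vE mulr1.
  exact: (submodpZ v sb bu).
have [u [t [au Kt rE]]] := KE r Kr; have [v [c [bv tE]]] := big r Kr nbr t Kt.
apply: nbr; rewrite rE tE.
have h1 := submodpZ x sb bv; have h2 := submodpZ c sb xr.
have -> : u + x * (v + r * c) = u + (x * v + c * (x * r)) by ring.
exact: (submodpD sb (ab _ au) (submodpD sb h1 h2)).
Qed.

Lemma wreg_rcons a x s : submodp a -> (x : R^o) \in m ->
  wreg a (x :: s) -> wreg a (rcons s x).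
Proof.
elim: s a => [//|y s IH] a sa xm [nx [ny ws]].
have [ny' nx'] := nzdiv_swap sa xm nx ny.
split=> //; apply: IH => //; first exact: submodp_adj.
by split=> //; rewrite adjC.
Qed.

(** The members of [s] travel one at a time from the front to the end, by adjacent swaps. *)
Lemma wreg_catC a s t : submodp a -> (forall x : R, x \in s -> (x : R^o) \in m) ->
  wreg a (s ++ t) -> wreg a (t ++ s).
Proof.
move=> sa; elim: s t => [|x s IH] t sm' w; first by rewrite cats0.
have xm : (x : R^o) \in m by apply: sm'; exact: mem_head.
rewrite -cat_rcons; apply: IH => [y ys|].
  by apply: sm'; rewrite inE ys orbT.
by rewrite -rcons_cat; exact: wreg_rcons.
Qed.

Lemma simple_len b (u : R) : submodp b -> ~ b u ->
  (forall x : R, (x : R^o) \in m -> b (x * u)) -> flen b (adj b u) 1.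
Proof.
move=> sb nbu mu; split.
  exists b; split=> //; split; first exact: sub_adj.
  by exists u => //; exact: adj_mem.
move=> t; rewrite leqNgt => h; apply/negP => t1.
have /= [W1 [sW1 [W0 [sW0 bW0 [W01 [w W1w W0w]]]] [W1b [z bz W1z]]]] := hc_leq t1 h.
have bW1 x : b x -> W1 x by move=> /bW0 /W01.
apply: W1z; suff W1u : W1 u by apply: adj_sub bz.
have [v [c [bv wE]]] := W1b _ W1w.
have cm : (c : R^o) \notin m.
  apply/negP => cm; apply: W0w; apply: bW0; rewrite wE; apply: submodpD => //.
  by rewrite mulrC; exact: mu.
have [e ec] := local_unit cm.
have -> : u = e * (w - v) by rewrite wE addrC addKr mulrCA ec mulr1.
by apply: (submodpZ e sW1); apply: submodpB => //; exact: bW1.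
Qed.

Lemma residue_len : flen (fun x => x \in m) (@allsm R R^o) 1.
Proof.
apply: flen_eq (simple_len sm (u := 1) _ _) => // [v||x xm].
- by split=> // _; exists 0, v; rewrite mul1r add0r rpred0.
- exact/negP/local_one.
- by rewrite mulr1.
Qed.

(** Take [b] maximal with b/a of finite length. If [b] is proper, choose u outside [b] with b : u
    maximal; nilpotency then puts m u inside [b], so b + (u) contradicts the choice of [b]. *)
Lemma nilpotent_len a : submodp a ->
  (forall x : R, (x : R^o) \in m -> exists t, a (x ^+ t)) ->
  exists r, flen a allsm r.
Proof.
move=> sa nil; pose F b := [/\ submodp b, subp a b & exists r, flen a b r].
have [||b [[sb ab [r hr]] mb]] := @noeth_max F; first by move=> b [].
  by exists a; split=> //; exists 0%N; exact: flen0.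
have [b1|b1] := pselect (b 1).
  exists r; apply: flen_eq hr => // v; split=> // _.
  by rewrite -[v]mulr1; exact: (submodpZ v sb b1).
pose col u : R^o -> Prop := fun x => b (x * u).
have scol u : submodp (col u).
  split; first by rewrite /col mul0r; case: sb.
  move=> c x y cx cy; rewrite /col.
  have -> : (c *: x + y) * u = c * (x * u) + y * u by rewrite /GRing.scale /=; ring.
  by apply sb.
pose G c := exists u, ~ b u /\ c = col u.
have [||c [[u [bu ->]] mc]] := @noeth_max G; first by move=> _ [u [_ ->]].
  by exists (col 1), 1.
have mu x : (x : R^o) \in m -> b (x * u).
  move=> xm; apply: contrapT => nb.
  (* As long as x^(t+1) u is outside [b], maximality gives b : x^(t+1) u = b : u, which does not
     contain x. Hence no power of x carries u into [b]. *)
  have pw t : ~ b (x ^+ t * u) /\ (b (x * (x ^+ t * u)) -> False).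
    elim: t => [|t [h1 h2]]; first by rewrite expr0 mul1r.
    rewrite exprS -mulrA; split=> // h; apply: nb.
    have sub : subp (col u) (col (x * (x ^+ t * u))).
      move=> y cy; rewrite /col.
      have -> : y * (x * (x ^+ t * u)) = (x ^+ t.+1) * (y * u) by rewrite exprS; ring.
      exact: (submodpZ _ sb cy).
    by apply: (mc _ _ sub) => //; exists (x * (x ^+ t * u)).
  have [t at_] := nil x xm; case: (pw t) => + _; apply.
  by rewrite mulrC; exact: (submodpZ u sb (ab _ at_)).
have h1 := simple_len sb bu mu.
case: bu; apply: mb (adj_mem u sb); last exact: sub_adj.
split; [exact: submodp_adj|by move=> z /ab; exact: sub_adj|].
exists (r + 1)%N; apply: flen_add hr h1 => //; exact: submodp_adj.
Qed.

(* A prime other than m containing (s) would end a chain of n + 1 primes, which m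
   would extend. *)
Lemma wreg_len n s : krull_dim R = n%:Z%:E -> size s = n -> wreg zerosm s ->
  ~ idl zerosm s (1 : R) -> exists r, flen (idl zerosm s) allsm r.
Proof.
move=> hn sn ws s1; have sz := @submodp_zero R R^o; have sJ := submodp_idl s sz.
apply: nilpotent_len => // x xm; apply: contrapT => no.
have [|||q [pq Jq Sq]] := @prime_avoiding _ (fun z => exists t, z = x ^+ t) sJ.
- by exists 0%N.
- by move=> _ _ [t ->] [t' ->]; exists (t + t')%N; rewrite exprD.
- by move=> _ [t ->] h; apply: no; exists t.
have [sq q1 _] := pq.
suff /(krull_dim_pchain hn) : pchain n.+1 (fun x => x \in m) by rewrite ltnn.
split; first exact: prime_local.
exists q; split; first by rewrite -sn; exact: wreg_pchain Jq.
split; first exact: proper_local.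
by exists x => //; apply: Sq; exists 1%N.
Qed.

(** * Duality over a quotient with simple socle *)

Section Duality.
Variable J : R^o -> Prop.
Hypothesis sJ : submodp J.

Definition colon b : R^o -> Prop := fun u => forall x, b x -> J (x * u).

Definition socle : R^o -> Prop := colon (fun x => x \in m).

Lemma submodp_colon b : submodp (colon b).
Proof.
split=> [x _|c u v cu cv x bx]; first by rewrite mulr0; case: sJ.
have -> : x * (c *: u + v) = c * (x * u) + x * v by rewrite /GRing.scale /=; ring.
by apply sJ; [exact: cu|exact: cv].
Qed.

Lemma sub_colon b : subp J (colon b).
Proof. by move=> u Ju x _; exact: (submodpZ x sJ Ju). Qed.

Lemma colon_sub a b : subp a b -> subp (colon b) (colon a).
Proof. by move=> ab u cu x /ab; exact: cu. Qed.

Hypothesis soc1 : flen J socle 1.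

(** With t generating [b] over [a], multiplication by t embeds (J : a)/(J : b) into the socle of
    R/J. *)
Lemma colon_simple a b : submodp a -> submodp b -> flen a b 1 ->
  exists2 r, flen (colon b) (colon a) r & (r <= 1)%N.
Proof.
move=> sa sb [/= [W [sW aW [Wb [t bt Wt]]]] mab].
have nat : ~ a t by move=> /aW.
have ab : subp a b by move=> x /aW /Wb.
have big z : b z -> ~ a z -> subp b (adj a z).
  move=> bz az w bw; apply: contrapT => nw.
  suff /mab : hc 2 a b by [].
  exists (adj a z); split; first exact: submodp_adj.
    exists a; split=> //; split; first exact: sub_adj.
    by exists z => //; exact: adj_mem.
  by split; [exact: adj_sub|exists w].
have mt x : (x : R^o) \in m -> a (x * t).
  move=> xm; apply: contrapT => nb.
  have [u [c [au tE]]] := big _ (submodpZ x sb bt) nb t bt.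
  have [v vE] := sub1_unit c xm; apply: nat.
  have -> : t = v * u.
    have -> : u = t * (1 - x * c) by rewrite mulrBr mulr1 {1}tE /GRing.scale /=; ring.
    by rewrite mulrCA vE mulr1.
  exact: (submodpZ v sa au).
have sca := submodp_colon a; have scb := submodp_colon b.
have kE u : kery t (colon a) J u <-> colon b u.
  split=> [[cu Jtu] x /(big t bt nat)[v [c [av ->]]]|cu].
    have -> : (v + t * c) * u = v * u + c * (t * u) by ring.
    by apply: submodpD => //; [exact: cu|exact: (submodpZ c sJ Jtu)].
  by split; [exact: colon_sub cu|exact: cu].
have sI := submodp_imy t sca sJ.
have Isoc : subp (imy t (colon a) J) socle.
  move=> _ [u [v [cu Jv ->]]] x xm.
  have -> : x * (v + t *: u) = x * v + (x * t) * u by rewrite /GRing.scale /=; ring.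
  apply: submodpD => //; first exact: (submodpZ x sJ Jv).
  by apply: cu; exact: mt.
have JI := @sub_imy _ _ t (colon a) J sca.
have [e [f [ef he _]]] := flen_split sJ sI (submodp_colon _) JI Isoc soc1.
exists e; last by rewrite -ef leq_addr.
apply: flen_eq (fun v => kE v) (fun v => iff_refl _) _.
apply: (sqiso_flen _ _ _ _ _ _ (sqiso_sym (@mul_sqiso _ _ t _ _ sca sJ)) he) => //.
- exact: submodp_kery.
- by move=> u [].
Qed.

Lemma colon_len a b r : submodp a -> submodp b -> flen a b r ->
  exists2 r', flen (colon b) (colon a) r' & (r' <= r)%N.
Proof.
move=> sa; elim: r b => [|r IH] b sb h.
  exists 0%N => //; apply: flen0; apply: colon_sub; last exact: flen0_sub h.
  exact: flen_sub h.
have /= [W [sW hW [Wb [t bt Wt]]]] := h.1.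
have aW := hc_sub hW.
have [e [f [ef he hf]]] := flen_split sa sW sb aW Wb h.
have re : (r <= e)%N by exact: he.2.
have f1 : (1 <= f)%N by apply: hf.2; exists W; split=> //; split=> //; exists t.
have [e' f'] : e = r /\ f = 1%N by lia.
rewrite {}e' in he; rewrite {}f' in hf.
have [r1 h1 l1] := IH W sW he; have [r2 h2 l2] := colon_simple sW sb hf.
exists (r2 + r1)%N; last by lia.
by apply: flen_add h2 h1; exact: submodp_colon.
Qed.

Lemma colon_dual b L e : submodp b -> subp J b -> flen J allsm L ->
  flen b allsm e -> flen J (colon b) e.
Proof.
move=> sb Jb hL hb.
have [p [q [pq hp hq]]] := flen_split sJ sb submodp_all Jb (fun _ _ => I) hL.
have qe := flen_uniq hq hb.
have [q' hq' lq] := colon_len sb submodp_all hq.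
have [p' hp' lp] := colon_len sJ sb hp.
have cJ v : colon J v <-> allsm v.
  by split=> // _ x Jx; rewrite mulrC; exact: (submodpZ v sJ Jx).
have call v : colon allsm v <-> J v.
  by split=> [/(_ 1 I)|/sub_colon]; rewrite ?mul1r.
have {}hq' := flen_eq call (fun v => iff_refl _) hq'.
have {}hp' := flen_eq (fun v => iff_refl _) cJ hp'.
have := flen_uniq hL (flen_add sJ (submodp_colon b) submodp_all hq' hp').
move=> E; suff <- : q' = e by [].
lia.
Qed.

End Duality.
End Local.
End Noetherian.

(** * The Koszul complex *)

Section Cone.
Variables (R : comNzRingType) (w : R).

Definition cone0 (A B : lmodType R) (f : {linear A -> B}) (p : A * B) : B :=
  f p.1 + w *: p.2.

Lemma cone0_is_linear (A B : lmodType R) (f : {linear A -> B}) : linear (cone0 f).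
Proof.
move=> a u v; rewrite /cone0 linearP scalerDr !scalerA [w * a]mulrC -!scalerA.
by rewrite scalerDr addrACA.
Qed.
HB.instance Definition _ (A B : lmodType R) (f : {linear A -> B}) :=
  GRing.isLinear.Build R (A * B)%type B *:%R (cone0 f) (cone0_is_linear f).

Definition coneS (A B C : lmodType R) (f : {linear A -> B}) (g : {linear B -> C})
  (p : A * B) : B * C := (f p.1 + w *: p.2, - g p.2).

Lemma coneS_is_linear (A B C : lmodType R) (f : {linear A -> B}) (g : {linear B -> C}) :
  linear (coneS f g).
Proof.
move=> a u v; rewrite /coneS [RHS]surjective_pairing; congr (_, _) => /=.
  exact: cone0_is_linear.
by rewrite linearP opprD -scalerN.
Qed.
HB.instance Definition _ (A B C : lmodType R) (f : {linear A -> B}) (g : {linear B -> C}) :=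
  GRing.isLinear.Build R (A * B)%type (B * C)%type *:%R (coneS f g) (coneS_is_linear f g).

End Cone.

Section Koszul.
Variable R : comNzRingType.
Implicit Types (a b : R^o -> Prop) (z : seq R).

(** An iterated mapping cone of multiplications: the modules depend only on the number of elements,
    the differentials on their values. The zero module ['rV[R]_0] fills the degrees above the
    top. *)
Fixpoint kos n i : lmodType R :=
  match n, i with
  | 0, 0 => R^o
  | 0, _.+1 => 'rV[R]_0
  | n'.+1, 0 => kos n' 0
  | n'.+1, j.+1 => (kos n' j.+1 * kos n' j)%type
  end.

Fixpoint kosd z : forall i, {linear kos (size z) i.+1 -> kos (size z) i} :=
  match z with
  | [::] => fun i => \0
  | w :: z' => fun i =>
      match i with
      | 0 => cone0 w (kosd z' 0)
      | j.+1 => coneS w (kosd z' j.+1) (kosd z' j)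
      end
  end.

Fixpoint koscoef n a i : kos n i -> Prop :=
  match n, i return kos n i -> Prop with
  | 0, 0 => fun r => a r
  | 0, _.+1 => fun=> True
  | n'.+1, 0 => @koscoef n' a 0
  | n'.+1, j.+1 => fun p => @koscoef n' a j.+1 p.1 /\ @koscoef n' a j p.2
  end.
Arguments koscoef n a i p : clear implicits.

Lemma kosd_dd z i x : kosd z i (kosd z i.+1 x) = 0.
Proof.
elim: z i x => [|w z IH] [|i] x //=; rewrite /cone0 /coneS /=.
  by rewrite linearD IH add0r linearZ scalerN subrr.
by rewrite linearD IH add0r linearZ scalerN subrr [kosd _ _ (- _)]linearN IH !oppr0.
Qed.

Lemma kos_triv n i (p : kos n i) : (n < i)%N -> p = 0.
Proof.
elim: n i p => [|n IH] [|i] p //= ni; first exact: thinmx0.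
by case: p => p q; rewrite (IH _ p (leqW ni)) (IH _ q ni).
Qed.

Lemma submodp_koscoef n a i : submodp a -> submodp (koscoef n a i).
Proof.
move=> sa; elim: n i => [|n IH] [|i] /=; [exact: sa|exact: submodp_all|exact: IH|].
split=> [|c u v [u1 u2] [v1 v2]]; first by split; case: (IH i.+1); case: (IH i).
by split; [apply (IH i.+1)|apply (IH i)].
Qed.

Lemma koscoef_d z a i p : submodp a -> koscoef (size z) a i.+1 p ->
  koscoef (size z) a i (kosd z i p).
Proof.
move=> sa; elim: z i p => [|w z IH] [|i] p /=.
- by move=> _; case: sa.
- by [].
- move=> [p1 p2]; rewrite /cone0; apply: submodpD; first exact: submodp_koscoef.
    exact: IH.
  by apply: submodpZ => //; exact: submodp_koscoef.
- move=> [p1 p2]; split=> /=; last first.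
    by apply: submodpN; [exact: submodp_koscoef|exact: IH].
  apply: submodpD; first exact: submodp_koscoef.
    exact: IH.
  by apply: submodpZ => //; exact: submodp_koscoef.
Qed.

Lemma koscoef_adj n a y i p : submodp a ->
  koscoef n (adj a y) i p <-> exists q r, koscoef n a i q /\ p = q + y *: r.
Proof.
move=> sa; elim: n i p => [|n IH] [|i] p /=; [by []| |exact: IH|].
  split=> // _; exists 0, 0; split=> //; exact: etrans (thinmx0 _) (esym (thinmx0 _)).
split=> [[/IH[q [r [qa E]]] /IH[q' [r' [qa' E']]]]|].
  by exists (q, q'), (r, r'); split=> //; rewrite [LHS]surjective_pairing E E'.
move=> [[q q'] [[r r'] [/= [qa qa'] ->]]].
by split; apply/IH; [exists q, r|exists q', r'].
Qed.

Lemma kos_sys z : coefsys (kosd z) (fun a i => koscoef (size z) a i).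
Proof.
split=> [a sa|a y sa|a y sa ny].
- by split=> [i|i p]; [exact: submodp_koscoef|exact: koscoef_d].
- apply: functional_extensionality_dep => i; apply/funext => p; apply/propext.
  exact: koscoef_adj.
- elim: (size z) => [|n IH] [|i] p //=; [exact: ny|exact: IH|].
  by move=> [/IH p1 /IH p2].
Qed.

(** For the head of [z] the contracting map is the inclusion of the shifted copy; for a later
    element it is the earlier homotopy, with a sign on the shifted copy. The last clause makes it
    descend to the quotient by [b]. *)
Lemma kos_homotopy z y : y \in z ->
  exists h : forall i, kos (size z) i -> kos (size z) i.+1,
  [/\ forall i, linear (h i),
      forall p, kosd z 0 (h 0%N p) = y *: p,
      forall i p, kosd z i.+1 (h i.+1 p) + h i (kosd z i p) = y *: p
    & forall b i p, submodp b -> koscoef (size z) b i p -> koscoef (size z) b i.+1 (h i p)].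
Proof.
elim: z => [//|w z IH]; rewrite inE => /orP[/eqP ->|/IH[h [hl h0 hS hc]]].
  exists (fun i => match i return kos (size z).+1 i -> kos (size z).+1 i.+1 with
    | 0 => fun u => (0, u) | j.+1 => fun p => (0, p.1) end); split.
  - by case=> [|i] c u v; rewrite [RHS]surjective_pairing /= scaler0 addr0.
  - by move=> p /=; rewrite /cone0 /= linear0 add0r.
  - case=> [|i] p /=; rewrite /coneS /cone0 [LHS]surjective_pairing [RHS]surjective_pairing /=;
      congr (_, _); rewrite ?linear0 ?add0r ?addr0//.
    + by rewrite addKr.
    + by rewrite addKr.
  - move=> b [|i] p sb /= pb; split=> //; last by case: pb.
    + exact: submodp0 (@submodp_koscoef _ _ _ sb).
    + exact: submodp0 (@submodp_koscoef _ _ _ sb).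
have hD i u v c : h i (u + c *: v) = h i u + c *: h i v.
  by rewrite addrC hl addrC.
have h00 i : h i 0 = 0.
  by have := hl i (-1) 0 0; rewrite scaler0 addr0 scaleN1r addNr.
have hN i u : h i (- u) = - h i u.
  by rewrite -scaleN1r -[_ *: _]addr0 hl h00 addr0 scaleN1r.
exists (fun i => match i return kos (size z).+1 i -> kos (size z).+1 i.+1 with
  | 0 => fun u => (h 0%N u, 0) | j.+1 => fun p => (h j.+1 p.1, - h j p.2) end); split.
- case=> [|i] c u v; rewrite [RHS]surjective_pairing /= hl ?scaler0 ?addr0//.
  by rewrite hl opprD scalerN.
- by move=> p /=; rewrite /cone0 /= scaler0 addr0 h0.
- case=> [|i] p /=; rewrite /coneS /cone0 [LHS]surjective_pairing [RHS]surjective_pairing /=;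
    congr (_, _).
  + by rewrite hD scalerN addrACA hS addNr addr0.
  + by rewrite addr0 linearN opprK h0.
  + by rewrite hD scalerN addrACA hS addNr addr0.
  + by rewrite linearN opprK hN opprK hS.
- move=> b [|i] p sb /= pb; first by split; [exact: hc|exact: submodp0 (@submodp_koscoef _ _ _ sb)].
  case: pb => p1 p2; split; first exact: hc.
  by apply: submodpN; [exact: submodp_koscoef|exact: hc].
Qed.

Lemma kos_kills z y b : submodp b -> y \in z ->
  kills (kosd z) y (koscoef (size z) b).
Proof.
move=> sb /kos_homotopy[h [hl h0 hS hc]] [|i] p cp.
  exists (h 0%N p), 0; rewrite h0 addr0; split=> //.
  exact: submodp0 (@submodp_koscoef _ _ _ sb).
by exists (h i.+1 p), (h i (kosd z i p)); rewrite hS; split=> //; exact: hc.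
Qed.

Lemma kos_vanish z a i : submodp a -> (size z < i)%N ->
  vanish (kosd z) (koscoef (size z) a) i.
Proof.
move=> sa zi p _; exists 0, 0; rewrite linear0 addr0.
by split; [exact: submodp0 (@submodp_koscoef _ _ _ sa)|exact: kos_triv].
Qed.

Lemma kos_ground n : exists f : {linear kos n 0 -> R^o},
  [/\ forall p, f p = 0 -> p = 0, forall r, exists p, f p = r
    & forall a p, koscoef n a 0 p <-> a (f p)].
Proof.
elim: n => [|n [f fP]]; last by exists f.
by exists idfun; split=> // r; exists r.
Qed.

(** [rev] appears because the head of [z] is the outermost cone, hence the last element adjoined to
    [a]. *)
Lemma kos_H0 z a : submodp a ->
  sqiso (allsm : R^o -> Prop) (idl a (rev z))
        (cyc (kosd z) (koscoef (size z) a) 0) (bnd (kosd z) (koscoef (size z) a) 0).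
Proof.
move=> sa; have [f [finj fsurj fa]] := kos_ground (size z).
have fE p q : f p = f q -> p = q.
  by move=> e; apply/eqP; rewrite -subr_eq0; apply/eqP/finj; rewrite linearB e subrr.
exists (fun r p => f p = r); split.
- by split=> [|c u v u' v' <- <-]; rewrite ?linear0// linearP.
- by move=> r _; have [p <-] := fsurj r; exists p.
- by move=> p _; exists (f p).
- move=> _ p _ _ <-.
  elim: z f finj fsurj fa fE p => [|w z IH] f finj fsurj fa fE p.
    split=> [ap|[q [r [ar ->]]]]; last first.
      by rewrite (_ : kosd [::] 0 q = 0) ?add0r//; exact: (fa a r).1 ar.
    by exists 0, p; rewrite linear0 add0r; split=> //; exact: (fa a p).2 ap.
  have {}IH q := IH (f : {linear kos (size z) 0 -> R^o}) finj fsurj fa fE q.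
  rewrite rev_cons -cats1 idl_cat /=; split=> [[u [r [bu e]]]|[[q1 q2] [s [as_ ->]]]].
    have [p1 p1E] := fsurj u; have [p2 p2E] := fsurj r.
    have [q [s [as_ qE]]] : bnd (kosd z) (koscoef (size z) a) 0 p1.
      by apply/IH; rewrite p1E.
    exists (q, p2), s; split=> //; apply: fE; rewrite e -p1E -p2E qE /= /cone0 /= !linearD linearZ.
    by rewrite addrAC.
  exists (f (kosd z 0 q1 + s)), (f q2); split.
    by apply/IH; exists q1, s.
  by rewrite /= /cone0 /= !linearD linearZ /= addrAC.
Qed.

Fixpoint ktop n : R^o -> kos n n :=
  if n is n'.+1 return R^o -> kos n n then fun r => (0, ktop n' r) else id.

Lemma ktop_linear n : linear (ktop n).
Proof.
elim: n => [//|n IH] c u v.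
by rewrite [RHS]surjective_pairing /= IH scaler0 addr0.
Qed.

Lemma ktop_surj n p : exists r, ktop n r = p.
Proof.
elim: n p => [|n IH] p; first by exists p.
case: p => p q; have [r <-] := IH q; exists r.
by rewrite /= (kos_triv p (ltnSn n)).
Qed.

Lemma ktop_coef n a r : submodp a -> koscoef n a n (ktop n r) <-> a r.
Proof.
move=> sa; elim: n => [//|n IH] /=; split=> [[_ /IH]//|/IH ar]; split=> //.
exact: submodp0 (@submodp_koscoef _ _ _ sa).
Qed.

Lemma koscoef_d0 w z a i (p : kos (size z) i) : submodp a ->
  koscoef (size z).+1 a i (kosd (w :: z) i (0, p)) <->
  koscoef (size z) a i (w *: p) /\ cyc (kosd z) (koscoef (size z) a) i p.
Proof.
move=> sa; case: i p => [|i] p /=; first by rewrite /cone0 /= linear0 add0r; split=> [|[]].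
rewrite linear0 add0r; split=> -[wp dp]; split=> //.
  by rewrite -[kosd z i p]opprK; apply: submodpN => //; exact: submodp_koscoef.
by apply: submodpN => //; exact: submodp_koscoef.
Qed.

Lemma ktop_cyc z a r : submodp a ->
  cyc (kosd z) (koscoef (size z) a) (size z) (ktop (size z) r) <->
  forall w, w \in z -> a (w * r).
Proof.
move=> sa; elim: z => [|w z IH]; first by split.
have k0 : ktop (size z) 0 = 0.
  by have := ktop_linear (size z) (-1) 0 0; rewrite scaler0 addr0 scaleN1r addNr.
have wr : w *: ktop (size z) r = ktop (size z) (w * r).
  by have := ktop_linear (size z) w r 0; rewrite !addr0 k0 addr0.
have D := @koscoef_d0 w z a (size z) (ktop (size z) r) sa.
split=> [/D[]|H].
  rewrite wr => /(ktop_coef _ _ sa) ar /IH H v.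
  by rewrite inE => /orP[/eqP ->//|/H].
apply/D; rewrite wr; split.
  by apply/(ktop_coef _ _ sa); apply: H; exact: mem_head.
by apply/IH => v vz; apply: H; rewrite inE vz orbT.
Qed.

(** The module above the top degree is zero, so only elements of aK bound; and the differential of r
    times the top basis element has the coefficients w r up to sign. *)
Lemma kos_Htop z a : submodp a ->
  sqiso (fun r : R^o => forall w, w \in z -> a (w * r)) a
    (cyc (kosd z) (koscoef (size z) a) (size z)) (bnd (kosd z) (koscoef (size z) a) (size z)).
Proof.
move=> sa; exists (fun r p => ktop (size z) r = p); split.
- split; last by move=> c u v _ _ <- <-; exact: ktop_linear.
  by have := ktop_linear (size z) (-1) 0 0; rewrite scaler0 addr0 scaleN1r addNr.
- by move=> r /(ktop_cyc _ _ sa) cr; exists (ktop (size z) r).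
- by move=> p; have [r <-] := ktop_surj p; move=> /(ktop_cyc _ _ sa) cr; exists r.
- move=> r _ _ _ <-; split=> [ar|[q [s [cs e]]]].
    by exists 0, (ktop (size z) r); rewrite linear0 add0r; split=> //; apply/(ktop_coef _ _ sa).
  by apply/(ktop_coef (size z) _ sa); rewrite e (kos_triv q (ltnSn _)) linear0 add0r.
Qed.

Lemma kills_ideal (P : nat -> lmodType R) (d : forall i, {linear P i.+1 -> P i}) Q z y :
  (forall i x, d i (d i.+1 x) = 0) -> subcplx d Q ->
  (forall w, w \in z -> kills d w Q) -> idl zerosm z y -> kills d y Q.
Proof.
move=> dd cQ k zy i p cp; have sb := submodp_bnd i cQ.
pose K : R^o -> Prop := fun y => bnd d Q i (y *: p).
suff : K y by [].
apply: idl_sub zy => [|_ ->|w /k kw]; last exact: kw.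
  split=> [|c u v Ku Kv]; first by rewrite /K scale0r; case: sb.
  by rewrite /K scalerDl -scalerA; apply sb.
by rewrite /K scale0r; case: sb.
Qed.

(* The socle of R/(s) is the top Koszul homology H_n(z; R/(s)), which has the
   length of H_0(z; R) = R/m. *)
Lemma socle_len (m : submodClosed R^o) z s : noetherian R -> local_ring m ->
  m =i ideal_gen z -> size s = size z -> wreg zerosm s ->
  (forall y : R, y \in s -> (y : R^o) \in m) -> flen (idl zerosm s) (socle m (idl zerosm s)) 1.
Proof.
move=> nR lR mz sz ws sm; have s0 := @submodp_zero R R^o.
set J := idl zerosm s; have sJ : submodp J := submodp_idl s s0.
have dd := kosd_dd (z := z); have cE := kos_sys z; have [cs _ _] := cE.
have kill b y : submodp b -> y \in s -> kills (kosd z) y (koscoef (size z) b).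
  move=> sb /sm; rewrite mz => /ideal_genE; apply: kills_ideal => //; first exact: cs.
  by move=> w; exact: kos_kills.
(* The bound reaches exactly 0 because [s] and [z] have equal size: the start is vanishing above
   [size z]. *)
have v0 : forall i, (0 < i)%N -> vanish (kosd z) (koscoef (size z) zerosm) i.
  apply: (vanish_idl dd cE s0 ws kill) => i; rewrite add0n sz.
  exact: kos_vanish.
have sc i : submodp (cyc (kosd z) (koscoef (size z) zerosm) i) by exact/submodp_cyc/cs.
have sb i : submodp (bnd (kosd z) (koscoef (size z) zerosm) i) by exact/submodp_bnd/cs.
have h i : flen (bnd (kosd z) (koscoef (size z) zerosm) i)
    (cyc (kosd z) (koscoef (size z) zerosm) i) ('C(0, i) * 1).
  case: i => [|i]; last by apply: (flen_vanish dd); [exact: cs|exact: v0].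
  apply: (sqiso_flen _ _ _ _ _ _ (kos_H0 z s0)) => //; first exact: submodp_idl.
  apply: flen_eq (residue_len nR lR) => // x; rewrite mz; split.
      move=> /ideal_genE; apply: idl_sub; first exact: submodp_idl.
        exact: sub_idl.
      by move=> y yz; apply: idl_mem => //; rewrite mem_rev.
    move=> h; apply/ideal_genE; apply: idl_sub h; first exact: submodp_idl.
      exact: sub_idl.
    by move=> y; rewrite mem_rev => yz; exact: idl_mem.
(* The coefficient of the top degree is the binomial of n over n, times the length 1 of R/m. *)
have := idl_kill dd cE s0 ws kill h (size z); rewrite add0n sz binn mul1n => hJ.
have soE r : (forall w, w \in z -> J (w * r)) <-> socle m J r.
  split=> [H x|H w wz]; last first.
    by apply: H; rewrite mz; apply/ideal_genE; exact: idl_mem.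
  rewrite mz => /ideal_genE.
  apply: (idl_sub (b := fun x : R^o => J (x * r))) => //.
    split=> [|c u v Ju Jv]; first by rewrite mul0r; case: sJ.
    have -> : (c *: u + v) * r = c * (u * r) + v * r by rewrite /GRing.scale /=; ring.
    by apply sJ.
  by move=> _ ->; rewrite mul0r; case: sJ.
have J1 v : J v <-> J v by [].
apply: (flen_eq J1 soE).
have soS : submodp (fun r : R^o => forall w, w \in z -> J (w * r)).
  have -> : (fun r : R^o => forall w, w \in z -> J (w * r)) = socle m J.
    by apply/funext => r; apply/propext.
  exact: submodp_colon.
apply: (sqiso_flen _ _ _ _ _ _ (sqiso_sym (kos_Htop z sJ))) hJ => //.
- exact/submodp_cyc/cs.
- exact/submodp_bnd/cs.
- by apply: (bnd_cyc dd); exact: cs.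
- by move=> r Jr w _; exact: (submodpZ w sJ Jr).
Qed.

End Koszul.

(** * Tor of quotients by regular sequences *)

Section CyclicModule.
Variable R : comNzRingType.
Implicit Types (a : R^o -> Prop) (s t : seq R).

Lemma pi_eq0 (V : lmodType R) (N : submodClosed V) (v : V) :
  \pi_(qmod N) v = 0 <-> v \in N.
Proof.
split=> [e|vN].
  have : v - 0 \in N by apply/qmod_eqP; rewrite e raddf0.
  by rewrite subr0.
have /qmod_eqP e : v - 0 \in N by rewrite subr0.
by rewrite [LHS]e raddf0.
Qed.

Lemma wreg_nth a s :
  (forall i, (i < size s)%N -> nzdiv (idl a (take i s)) s`_i) -> wreg a s.
Proof.
elim: s a => [//|y s IH] a H; split; first by have := H 0%N isT.
by apply: IH => i si; have := H i.+1 si.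
Qed.

Lemma idl_eq a s t : submodp a -> s =i t -> idl a s = idl a t.
Proof.
move=> sa st; apply/funext => x; apply/propext.
split; apply: idl_sub; try exact: submodp_idl; try exact: sub_idl.
  by move=> y ys; apply: idl_mem => //; rewrite -st.
by move=> y ys; apply: idl_mem => //; rewrite st.
Qed.

Section Cyclic.
Variables (M : lmodType R) (e : M) (a : R^o -> Prop).
Hypothesis sa : submodp a.
Hypothesis genM : forall x : M, exists r : R, x = r *: e.
Hypothesis annM : forall r : R, r *: e = 0 <-> a r.

(** Identifies M/(s)M with R/(a + (s)), which turns regularity on [M] into [wreg a]; it serves for M
    = R with a = 0 and for M = R/I. *)
Lemma seq_mulE s (r : R) : r *: e \in seq_mul M s <-> idl a s r.
Proof.
have si := submodp_idl s sa; split=> [/asboolP[t ts E]|].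
  pose Q (v : M) := exists2 r, v = r *: e & idl a s r.
  have sQ : submodp Q.
    split; first by exists 0; [rewrite scale0r|case: si].
    move=> c _ _ [u -> au] [v -> av]; exists (c * u + v); last by apply si.
    by rewrite scalerDl scalerA.
  have [r' E' ir'] : Q (r *: e).
    rewrite E; apply: submodp_sum_seq => // p /ts [y ys [v _ <-]].
    apply: submodpZ => //; have [c ->] := genM v; exists (y * c); first by rewrite scalerA.
    by rewrite mulrC; exact: (submodpZ c si (idl_mem sa ys)).
  rewrite -[r](subrK r'); apply: (submodpD si _ ir'); apply: sub_idl.
  by apply/annM; rewrite scalerBl E' subrr.
apply: (idl_sub (b := fun r : R^o => r *: e \in seq_mul M s)).
- split; first by rewrite scale0r rpred0.
  by move=> c u v u1 v1; rewrite scalerDl -scalerA rpredD// rpredZ.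
- by move=> u /annM ->; exact: rpred0.
- move=> y ys; apply/asboolP; exists [:: (1, y *: e)]; last by rewrite big_seq1 scale1r.
  by move=> p; rewrite inE => /eqP -> /=; exists y => //; exists e.
Qed.

Lemma regular_seq_wreg s : regular_seq M s -> wreg a s /\ ~ idl a s 1.
Proof.
move=> [reg [x x0]]; split.
  apply: wreg_nth => i si r /seq_mulE h; apply/seq_mulE.
  apply/pi_eq0; apply: (reg i si); rewrite -[RHS](raddf0 \pi_(qmod (seq_mul M (take i s)))).
  have /pi_eq0 E : s`_i *: (r *: e) \in seq_mul M (take i s) by rewrite scalerA.
  by rewrite raddf0 -E; exact: esym (pi_scale _ _ _).
move=> i1; apply: x0; rewrite -[x]reprK; have [r ->] := genM (repr x).
apply/pi_eq0/seq_mulE; rewrite -[r]mulr1.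
exact: (submodpZ r (submodp_idl s sa) i1).
Qed.

End Cyclic.

Lemma regular_seq_ring s : regular_seq R^o s -> wreg zerosm s /\ ~ idl zerosm s (1 : R).
Proof.
apply: (@regular_seq_wreg R^o 1 zerosm submodp_zero) => [x|r].
  by exists x; rewrite /GRing.scale /= mulr1.
by rewrite /GRing.scale /= mulr1.
Qed.

Lemma regular_seq_qmod (I : ideal R) s :
  regular_seq (qmod I) s -> wreg (fun x => x \in I) s /\ ~ idl (fun x => x \in I) s (1 : R).
Proof.
apply: (@regular_seq_wreg (qmod I) (\pi_(qmod I) (1 : R^o)) _ (submodp_mem I)).
  exact: qmod_one.
exact: qmod_oneZ.
Qed.

End CyclicModule.

Section QuotientTor.
Variables (R : comNzRingType) (I : ideal R).
Implicit Types (a b : R^o -> Prop) (s : seq R).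
Let M : lmodType R := qmod I.
Let d := free_res_diff M.
Let memI : R^o -> Prop := fun x => x \in I.

Let s0 : submodp (@zerosm R R^o) := submodp_zero.
Let sI : submodp memI := submodp_mem I.
Let dd := @free_res_dd R M.
Let sys := @coefres_sys R M.

Lemma sub_coefres a : submodp a -> subcplx d (coefres M a).
Proof. by case: sys => + _ _; exact. Qed.

Lemma coefres_kills_sub b (y : R) : submodp b -> (y : R^o) \in I -> kills d y (coefres M b).
Proof.
move=> sb yI; have -> : b = fun x => x \in (Defs.span b : submodClosed R^o).
  by apply/funext => x; apply/propext; rewrite in_span.
apply: coefres_kills => n; have [r ->] := qmod_one n.
rewrite scalerA; apply/qmod_oneZ; rewrite mulrC.
exact: (submodpZ r sI yI).
Qed.

Lemma coefres_H0 s :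
  sqiso (allsm : R^o -> Prop) (idl memI s)
    (cyc d (coefres M (idl zerosm s)) 0) (bnd d (coefres M (idl zerosm s)) 0).
Proof.
pose a := idl zerosm s; have sa : submodp a := submodp_idl s s0.
pose one : M := \pi_(qmod I) (1 : R^o).
exists (fun r p => aug M p = r *: one); split.
- split; first by rewrite linear0 scale0r.
  by move=> c u v u' v' e e'; rewrite linearP e e' scalerDl scalerA.
- by move=> r _; have [p e] := @aug_surj R M (r *: one); exists p.
- by move=> p _; have [r e] := qmod_one (aug M p); exists r.
- move=> r p _ _ e; split.
    move=> ir; have [i [r' [Ii ar' rE]]] : sumsm memI a r.
      apply: idl_sub ir.
      + exact: submodp_sumsm.
      + exact: subp_suml.
      + by move=> y ys; apply: subp_sumr => //; exact: idl_mem.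
    (* Since r = i + r' with i in I, subtracting r' times the basis element on the class of 1 from
       [p] leaves augmentation 0, hence a boundary. *)
    pose g : free_res M 0 := << r' *g one >>.
    have [q qE] : exists q, free_res_diff M 0 q = p - g.
      apply/free_res_exact0; rewrite linearB e rE.
      have -> : aug M g = r' *: one by rewrite [LHS]free_liftU.
      by rewrite scalerDl addrK; apply/qmod_oneZ.
    exists q, g; rewrite qE subrK; split=> // k.
    by rewrite coeffU mulrC; exact: (submodpZ _ sa ar').
  move=> [q [g [ag pE]]].
  have /(_ _ ag)[u Iu uE] : forall g, coefres M a 0 g ->
      exists2 u, idl memI s u & aug M g = u *: one.
    move=> g' ag'; rewrite (freeg_sum_sup (uniq_dom g') (fun x => id)) linear_sum.
    pose Q (v : M) := exists2 u, idl memI s u & v = u *: one.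
    apply: (@submodp_sum _ _ Q) => [|k].
      have sJ := submodp_idl s sI; split; first by exists 0; [case: sJ|rewrite scale0r].
      move=> c _ _ [u iu ->] [v iv ->]; exists (c * u + v); first by apply sJ.
      by rewrite scalerDl scalerA.
    have [c kE] := qmod_one (k : M); exists (c * coeff k g').
      have h : idl memI s (coeff k g').
        by apply: (idl_mono (a := zerosm)) (ag' k) => _ ->; case: sI.
      exact: (submodpZ c (submodp_idl s sI) h).
    have ak : aug M << k >> = k by rewrite [LHS]free_liftU scale1r.
    apply: etrans (linearZ_LR _ _ _) _; rewrite [aug M _]ak [X in _ *: X = _]kE.
    by rewrite scalerA mulrC.
  have E : r *: one = u *: one.
    rewrite -e pE linearD uE; have -> : aug M (d 0 q) = 0.
      by apply/free_res_exact0; exists q.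
    by rewrite add0r.
  rewrite -[r](subrK u); apply: (submodpD (submodp_idl s sI) _ Iu); apply: sub_idl.
  by apply/qmod_oneZ; rewrite scalerBl; apply/eqP; rewrite subr_eq0; apply/eqP.
Qed.

Lemma coefres_len0 s L : flen (idl memI s) allsm L ->
  flen (bnd d (coefres M (idl zerosm s)) 0) (cyc d (coefres M (idl zerosm s)) 0) L.
Proof.
apply: sqiso_flen (coefres_H0 s) => //; first exact: submodp_idl.
exact/submodp_bnd/sub_coefres/submodp_idl.
Qed.

Lemma len0_coefres s L :
  flen (bnd d (coefres M (idl zerosm s)) 0) (cyc d (coefres M (idl zerosm s)) 0) L ->
  flen (idl memI s) allsm L.
Proof.
apply: sqiso_flen (sqiso_sym (coefres_H0 s)) => //; last exact: submodp_idl.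
exact/submodp_bnd/sub_coefres/submodp_idl.
Qed.

Lemma coefres_rcons s (y : R) :
  coefres M (idl zerosm (rcons s y)) = addy (coefres M (idl zerosm s)) y.
Proof.
rewrite -cats1 idl_cat /=; case: sys => _ -> //; exact: submodp_idl.
Qed.

Lemma coefres_nzdiv s (y : R) : wreg zerosm (rcons s y) ->
  cnzdiv (coefres M (idl zerosm s)) y.
Proof.
rewrite -cats1 wreg_cat => -[_ [ny _]]; case: sys => _ _; apply=> //.
exact: submodp_idl.
Qed.

Lemma coefres_vanish s i : wreg zerosm s -> wreg memI s -> (0 < i)%N ->
  vanish d (coefres M (idl zerosm s)) i.
Proof.
elim/last_ind: s i => [|s y IH] i; first by move=> _ _; exact: coefres0_vanish.
move=> ws; have ny := coefres_nzdiv ws; move: ws.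
rewrite -cats1 !wreg_cat => -[ws _] [wI [nI _]] i0; rewrite cats1 coefres_rcons.
have cs := sub_coefres (submodp_idl s s0).
case: i i0 => // -[|i] _; apply: (addy_vanish dd) => //; try exact: IH.
  (* In degree 1 the kernel term is that of y on R/(I + (s)), zero by regularity; in higher degrees
     it vanishes by induction. *)
  have K := kery_sqiso y submodp_all (submodp_cyc 0 cs) (coefres_H0 s).
  have [rho [_ _ h e]] := K => p kp; have [r kr rp] := h _ kp.
  by apply/(e _ _ kr kp rp); case: kr => _; exact: nI.
by move=> p [cp _]; exact: IH cp.
Qed.

Lemma coefres_bin0 s L : wreg zerosm s -> wreg memI s -> flen (idl memI s) allsm L ->
  forall i, flen (bnd d (coefres M (idl zerosm s)) i)
                 (cyc d (coefres M (idl zerosm s)) i) ('C(0, i) * L).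
Proof.
move=> ws wI h [|i]; first by rewrite mul1n; exact: coefres_len0.
by apply: (flen_vanish dd); [exact/sub_coefres/submodp_idl|exact: coefres_vanish].
Qed.

(* On the finite length module T_0, the kernel and cokernel of y have the same
   length. *)
Lemma coefres_bin1 s (y : R) L : wreg zerosm (rcons s y) -> wreg memI s ->
  flen (idl memI s) allsm L ->
  exists e, forall i, flen (bnd d (coefres M (idl zerosm (rcons s y))) i)
                 (cyc d (coefres M (idl zerosm (rcons s y))) i) ('C(1, i) * e).
Proof.
move=> ws wI h; have ny := coefres_nzdiv ws.
have ws' : wreg zerosm s by move: ws; rewrite -cats1 wreg_cat => -[].
have cs := sub_coefres (submodp_idl s s0).
have sc i := submodp_cyc i cs; have sb i := submodp_bnd i cs.
have [e he ce] := flen_ker_coker y (sc 0%N) (sb 0%N) (coefres_len0 h).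
have hz i := coefres_bin0 ws' wI h i.+1.
exists e; rewrite coefres_rcons => -[|i].
  by rewrite mul1n; exact: (addy_flen0 dd).
have [z hk hc] := flen_ker_coker y (sc i.+1) (sb i.+1) (hz i).
have z0 : z = 0%N.
  have [p [q [pq hp _]]] := flen_split (sb i.+1) (submodp_kery y (sc _) (sb _)) (sc i.+1)
    (sub_kery y (sb _) (bnd_cyc dd cs)) (fun v (k : kery y _ _ v) => k.1) (hz i).
  by have := flen_uniq hk hp; move: pq; rewrite bin0n mul0n; lia.
rewrite {}z0 in hk hc; case: i hc hz hk => [|i] hc hz hk.
  by rewrite mul1n -[e]add0n; exact: (addy_flenS dd).
rewrite mul0n -[0%N]addn0; apply: (addy_flenS dd) => //.
apply: flen0; first by apply: sub_kery => //; exact: (bnd_cyc dd).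
by move=> p [cp _]; exact: (coefres_vanish ws' wI) cp.
Qed.

End QuotientTor.

Section TorLength.
Variable R : comNzRingType.
Implicit Types (I J : ideal R) (s t : seq R).

(** The factor [L] is left free; degree 0, where the binomial is 1, identifies it with the length of
    R/(I+J) in [Tor_len_mlength]. *)
Definition Tor_len I J k L := forall i,
  flen zerosm (allsm : Tor i (qmod I) (qmod J) -> Prop) ('C(k, i) * L).

Lemma gen_mem J s : J =i ideal_gen s -> (fun x : R^o => (x \in J : Prop)) = idl zerosm s.
Proof. by move=> Js; apply/funext => x; apply/propext; rewrite Js; exact: ideal_genE. Qed.

Lemma coefres_Tor_len I J s k L : J =i ideal_gen s ->
  (forall i, flen (bnd (free_res_diff (qmod I)) (coefres (qmod I) (idl zerosm s)) i)
     (cyc (free_res_diff (qmod I)) (coefres (qmod I) (idl zerosm s)) i) ('C(k, i) * L)) ->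
  Tor_len I J k L.
Proof. by move=> /gen_mem <- h i; exact: flen_Tor. Qed.

Lemma Tor_len_sym I J k L : Tor_len I J k L -> Tor_len J I k L.
Proof.
by move=> h i; apply: sqiso_flen (Tor_sym _ _ _) (h i) => //; exact: submodp_zero.
Qed.

Lemma flen_qmod I L : flen (fun x => x \in I) allsm L ->
  flen zerosm (allsm : qmod I -> Prop) L.
Proof.
apply: sqiso_flen => //; [exact: submodp_mem|exact: submodp_zero|].
exists (fun r h => h = \pi_(qmod I) r); split.
- by split=> [|c u v _ _ -> ->]; rewrite ?raddf0// linearP.
- by move=> r _; exists (\pi_(qmod I) r).
- by move=> h _; exists (repr h); rewrite ?reprK.
- by move=> r _ _ _ ->; split=> /pi_eq0.
Qed.

Lemma addsm_idl I J s (x : R^o) : J =i ideal_gen s ->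
  x \in addsm I J <-> idl (fun y => y \in I) s x.
Proof.
move=> Js; have sI := submodp_mem I; split.
  move=> /asboolP[u [v [Iu + ->]]]; rewrite Js => /ideal_genE iv.
  apply: submodpD; [exact: submodp_idl|exact: sub_idl|].
  by apply: idl_mono iv => _ ->; exact: rpred0.
apply: (idl_sub (b := fun x => x \in addsm I J)); first exact: submodp_mem.
  by move=> u Iu; apply/asboolP; exists u, 0; rewrite addr0 rpred0.
move=> y ys; apply/asboolP; exists 0, y; rewrite add0r rpred0; split=> //.
by rewrite Js; apply/ideal_genE; apply: idl_mem => //; exact: submodp_zero.
Qed.

Lemma Tor_len_mlength I J s k L i : J =i ideal_gen s -> Tor_len I J k L ->
  mlength (Tor i (qmod I) (qmod J)) = ('C(k, i)%:Z%:E * mlength (qmod (addsm I J)))%E.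
Proof.
move=> Js h; rewrite (mlength_flen (h i)); have := h 0%N; rewrite bin0 mul1n => h0.
suff hL : flen (fun x => x \in addsm I J) allsm L.
  by rewrite (mlength_flen (flen_qmod hL)) PoszM EFinM.
have : flen (idl (fun x => x \in I) s) allsm L.
  apply: len0_coefres; rewrite -(gen_mem Js).
  apply: sqiso_flen (Tor_coefres _ _ _) h0 => //; first exact: submodp_zero.
  exact: submodp_coefsys_bnd.
by apply: flen_eq => // x; split=> /(addsm_idl _ _ Js).
Qed.

Lemma coefres_kill I s t c L : wreg zerosm (s ++ t) ->
  (forall y : R, y \in t -> (y : R^o) \in I) ->
  (forall i, flen (bnd (free_res_diff (qmod I)) (coefres (qmod I) (idl zerosm s)) i)
     (cyc (free_res_diff (qmod I)) (coefres (qmod I) (idl zerosm s)) i) ('C(c, i) * L)) ->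
  forall i, flen (bnd (free_res_diff (qmod I)) (coefres (qmod I) (idl zerosm (s ++ t))) i)
     (cyc (free_res_diff (qmod I)) (coefres (qmod I) (idl zerosm (s ++ t))) i)
     ('C(c + size t, i) * L).
Proof.
move=> /wreg_cat[_ wt] tI h; rewrite idl_cat.
apply: (idl_kill (@free_res_dd R _) (@coefres_sys R _)) => //.
  exact: submodp_idl submodp_zero.
by move=> b y sb yt; apply: coefres_kills_sub => //; exact: tI.
Qed.

Lemma gen_sub I s : I =i ideal_gen s -> forall y : R, y \in s -> (y : R^o) \in I.
Proof.
by move=> Is y ys; rewrite Is; apply/ideal_genE; apply: idl_mem => //; exact: submodp_zero.
Qed.

Lemma Tor_len_sub I J t L : J =i ideal_gen t -> wreg zerosm t ->
  (forall y : R, y \in t -> (y : R^o) \in I) ->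
  flen (fun x => x \in I) allsm L -> Tor_len I J (size t) L.
Proof.
move=> Jt wt tI h; apply: (coefres_Tor_len Jt).
by apply: (@coefres_kill I [::] t 0 L) => //; exact: coefres_bin0.
Qed.

Lemma subset_gen I J s : {subset J <= I} -> J =i ideal_gen s ->
  forall y : R, y \in s -> (y : R^o) \in I.
Proof. by move=> JI Js y ys; apply: JI; exact: gen_sub Js _ ys. Qed.

(** Adjoining the members of [t] produces no homology above degree [size t], whereas degree [k] has
    length [L]. *)
Lemma Tor_len_vanish I J t k L : J =i ideal_gen t -> wreg zerosm t ->
  Tor_len I J k L -> (size t < k)%N -> L = 0%N.
Proof.
move=> Jt wt h tk; have := h k; rewrite binn mul1n => hk.
have v : vanish (free_res_diff (qmod I)) (coefres (qmod I) (idl zerosm t)) k.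
  apply: (idl_vanish (@free_res_dd R _) (@coefres_sys R _) (c := 0%N)) => // [|i i0].
    exact: submodp_zero.
  exact: coefres0_vanish.
have cs := sub_coefres I (submodp_idl t submodp_zero).
have := flen_vanish (@free_res_dd R _) cs v; rewrite -(gen_mem Jt) => /flen_Tor.
exact: flen_uniq.
Qed.

End TorLength.

(** * Lengths over a regular local ring, and the four cases *)

Section RegularLocal.
Variables (R : comNzRingType) (m : ideal R) (n : nat).
Hypothesis regR : regular_local_ring m.
Hypothesis dimR : krull_dim R = n%:Z%:E.
Implicit Types (I J : ideal R) (s t : seq R).

Let locR : local_ring m := regR.1.
Let noethR : noetherian R. Proof. by case: locR. Qed.

Lemma regular_len I s : I =i ideal_gen s -> size s = n -> regular_seq R^o s ->
  exists L, flen (fun x => x \in I) allsm L.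
Proof.
move=> Is sn /regular_seq_ring[ws s1]; rewrite (gen_mem Is).
exact: (wreg_len noethR locR dimR).
Qed.

(* The three nonzero Tor_i(R/J,R/(x,y)) have lengths g, g + e, e with g the
   length of R/(J+(x,y)) and e that of (J : (x,y))/J; these agree because R/J
   has a simple socle. *)
Lemma Tor_len2 J t (x y : R) I : J =i ideal_gen t -> size t = n -> regular_seq R^o t ->
  I =i ideal_gen [:: x; y] -> wreg zerosm [:: x; y] -> exists L, Tor_len J I 2 L.
Proof.
move=> Jt tn rt Ixy wxy; have [wt t1] := regular_seq_ring rt.
have [LJ hJ] := regular_len Jt tn rt.
have s0 := @submodp_zero R R^o; have sJ := submodp_mem J.
have wx : wreg zerosm (rcons [::] x) by case: wxy.
have [e1 h1] := coefres_bin1 wx (Logic.I : wreg (fun z => z \in J) [::]) hJ.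
pose M : lmodType R := qmod J; pose d := free_res_diff M.
pose Q := coefres M zerosm; pose Q1 := coefres M (idl zerosm [:: x]).
have dd := @free_res_dd R M.
have cQ : subcplx d Q := sub_coefres J s0.
have cQ1 : subcplx d Q1 := sub_coefres J (submodp_idl _ s0).
have sc i := submodp_cyc i cQ1; have sb i := submodp_bnd i cQ1.
have nx : cnzdiv Q x := @coefres_nzdiv R J [::] x wx.
have ny : cnzdiv Q1 y := @coefres_nzdiv R J [:: x] y wxy.
(* [g1] and [g0] are the common lengths of the kernel and cokernel of y on Tor_1 and on Tor_0 of R/J
   and R/(x). *)
have [g1 k1 c1] := flen_ker_coker y (sc 1%N) (sb 1%N) (h1 1%N).
have [g0 k0 c0] := flen_ker_coker y (sc 0%N) (sb 0%N) (h1 0%N).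
have v2 i : vanish d Q1 i.+2.
  by have := h1 i.+2; rewrite mul0n => /(flen0_sub (sb _)).
have l0 : flen (bnd d (addy Q1 y) 0) (cyc d (addy Q1 y) 0) g0 by exact: (addy_flen0 dd).
have l1 : flen (bnd d (addy Q1 y) 1) (cyc d (addy Q1 y) 1) (g1 + g0).
  exact: (addy_flenS dd).
have z i : flen (imy y (cyc d Q1 i.+2) (bnd d Q1 i.+2)) (cyc d Q1 i.+2) 0.
  apply: flen0; first by apply: imy_sub => //; exact: (bnd_cyc dd).
  by move=> p /v2; exact: sub_imy.
have l2 : flen (bnd d (addy Q1 y) 2) (cyc d (addy Q1 y) 2) g1.
  by rewrite -[g1]add0n; exact: (addy_flenS dd).
have l3 i : flen (bnd d (addy Q1 y) i.+3) (cyc d (addy Q1 y) i.+3) 0.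
  rewrite -[0%N]addn0; apply: (addy_flenS dd) => //.
  apply: flen0; first by apply: sub_kery => //; exact: (bnd_cyc dd).
  by move=> p [cp _]; exact: v2.
pose mJ : R^o -> Prop := fun z => z \in J.
have g01 : g1 = g0.
  have hb : flen (idl mJ [:: x; y]) allsm g0.
    by apply: (@len0_coefres R J [:: x; y]); rewrite (coefres_rcons J [:: x] y).
  have [zs [/eqP]] := regR.2; rewrite dimR eqe eqz_nat => /eqP zn mz.
  have sz : size t = size zs by rewrite zn.
  have tm (z' : R) : z' \in t -> (z' : R^o) \in m.
    move=> zt; apply: (proper_local noethR locR (submodp_idl t s0) t1).
    exact: idl_mem.
  have := socle_len noethR locR mz sz wt tm; rewrite -(gen_mem Jt) => soc.
  have sb' : submodp (idl mJ [:: x; y]) := submodp_idl _ sJ.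
  have dual := colon_dual noethR locR sJ soc sb' (@sub_idl _ mJ [:: x; y]) hJ hb.
  (* The resolution is exact in degree 1, so the cokernel term vanishes and Tor_1(R/J,R/(x)) is the
     kernel of x on R/J, that is (J : x)/J. *)
  have lE : liftcyc d Q x 1 = bnd d Q1 1.
    apply/funext => p; apply/propext; rewrite /Q1 (coefres_rcons J [::] x).
    split; last exact: (bnd_liftcyc dd).
    move=> [w [r [cw ->]]]; have [q [v [Qv ->]]] := coefres0_vanish (isT : 0 < 1)%N cw.
    by exists q, (v + x *: r); rewrite addrA; split=> //; exists v, r.
  have S1 := step_ker dd 0 cQ nx; rewrite lE in S1.
  have S2 := kery_sqiso x submodp_all (submodp_cyc 0 cQ) (coefres_H0 J [::]).
  have sk0 := submodp_kery x (submodp_cyc 0 cQ) (submodp_bnd 0 cQ).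
  have sk := submodp_kery x submodp_all sJ.
  have S3 : sqiso (kery x allsm mJ) mJ (cyc d Q1 1) (bnd d Q1 1).
    apply: (sqiso_trans sk0 S2); apply: sqiso_sym.
    by move: S1; rewrite /Q1 (coefres_rcons J [::] x).
  have S4 := kery_sqiso y sk (sc 1%N) S3.
  have skk := submodp_kery y sk sJ.
  have := sqiso_flen (submodp_kery y (sc 1%N) (sb 1%N)) (sb 1%N) skk sJ
    (sub_kery y (sb 1%N) (bnd_cyc dd cQ1)) (sub_kery y sJ (sub_kery x sJ (fun _ _ => Logic.I))) (sqiso_sym S4) k1.
  (* Inside (J : x)/J the kernel of y is (J : (x,y))/J, whose length duality has computed. *)
  have cE v : kery y (kery x allsm mJ) mJ v <-> colon mJ (idl mJ [:: x; y]) v.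
    split=> [[[_ xv] yv]|cv].
      have h : subp (idl mJ [:: x; y]) (fun w : R^o => mJ (w * v)).
        apply: idl_sub.
        - split=> [|c u u' ju ju']; first by rewrite /mJ mul0r rpred0.
          have -> : (c *: u + u') * v = c * (u * v) + u' * v by rewrite /GRing.scale /=; ring.
          by apply sJ.
        - by move=> u Ju; rewrite mulrC; exact: (submodpZ v sJ Ju).
        - by move=> w; rewrite !inE => /orP[] /eqP ->.
      by move=> w /h.
    have h w : w \in [:: x; y] -> mJ (w * v) by move=> wxy'; apply: cv; exact: idl_mem.
    by split; [split=> //|]; apply: h; rewrite !inE eqxx ?orbT.
  move=> h1'; apply: flen_uniq dual; apply: flen_eq h1' => //.
exists g0; apply: (coefres_Tor_len Ixy) => i.
have -> : coefres (qmod J) (idl zerosm [:: x; y]) = addy Q1 y by exact: (coefres_rcons J [:: x] y).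
case: i => [|[|[|i]]].
- by rewrite mul1n.
- by rewrite g01 addnn -mul2n in l1.
- by rewrite g01 in l2; rewrite mul1n.
- by rewrite bin_small// mul0n; exact: l3.
Qed.

Lemma proper_gen_local t : ~ idl zerosm t (1 : R) -> forall y : R, y \in t -> (y : R^o) \in m.
Proof.
move=> t1 y yt; apply: (proper_local noethR locR (submodp_idl t submodp_zero) t1).
by apply: idl_mem => //; exact: submodp_zero.
Qed.

(** The generators of [I] followed by [s] form a weakly regular sequence of length dim R. *)
Lemma regular_cat_len I x s : I =i ideal_gen x -> regular_seq R^o x ->
  regular_seq (qmod I) s -> (size x + size s)%N = n ->
  exists L, flen (idl (fun r => r \in I) s) allsm L.
Proof.
move=> Ix /regular_seq_ring[wx _] /regular_seq_qmod[ws s1] sz.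
have := @wreg_len _ noethR _ locR n (x ++ s) dimR; rewrite size_cat => /(_ sz).
rewrite idl_cat -(gen_mem Ix); apply=> //.
by apply/wreg_cat; rewrite -(gen_mem Ix).
Qed.

End RegularLocal.

Theorem theorem0p2 (R : comNzRingType) (m : ideal R) (n k : nat) (I J : ideal R)
    (hR : regular_local_ring m) (hn : krull_dim R = n%:Z%:E) (hkn : (k <= n)%N)
    (hI : gen_by_regular_seq I k) (hJ : gen_by_regular_seq J n)
    (hIJ : primary_to m (addsm I J))
    (hcases :
      [\/ {subset I <= J} \/ {subset J <= I},
          k = 2%N,
          (1 <= k <= n.-1)%N /\
          exists f : seq R,
            [/\ size f = n /\ regular_seq R^o f,
                J =i ideal_gen f,
                {subset ideal_gen (take k f) <= I}
              & regular_seq (qmod I) (drop k f)]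
        | [/\ (4 <= n)%N, (3 <= k <= n.-1)%N &
          exists f : seq R,
            [/\ size f = n /\ regular_seq R^o f,
                J =i ideal_gen f,
                {subset ideal_gen (take k.-1 f) <= I}
              & regular_seq (qmod I) (drop k f)]]])
    (i : nat) (hi : (i <= k)%N) :
  mlength (Tor i (qmod I) (qmod J))
    = (('C(k, i))%:Z%:E * mlength (qmod (addsm I J)))%E.
Proof.
have [x [xk rx Ix]] := hI; have [y [yn ry Jy]] := hJ.
have [wx x1] := regular_seq_ring rx; have [wy y1] := regular_seq_ring ry.
have s0 := @submodp_zero R R^o; have locR := hR.1; have [noethR _ _] := locR.
suff [L hL] : exists L, Tor_len I J k L by exact: Tor_len_mlength Jy hL.
have [LJ hLJ] := regular_len hR hn Jy yn ry.
have gen_in s : {subset ideal_gen s <= I} -> forall z : R, z \in s -> (z : R^o) \in I.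
  by move=> sI z zs; apply: sI; apply/ideal_genE; exact: idl_mem.
have genJ s : J =i ideal_gen s -> forall t, s =i t -> J =i ideal_gen t.
  move=> Js t st z; rewrite Js; apply/idP/idP => /ideal_genE h; apply/ideal_genE.
    by rewrite -(idl_eq s0 st).
  by rewrite (idl_eq s0 st).
case: hcases => [[IJ|JI]|k2|[/andP[k1 kn] [f [[fn rf] Jf fI rI]]]
    |[_ /andP[k3 kn] [f [[fn rf] Jf fI rI]]]].
(* The roles are exchanged: the generators of [I], all in [J], are adjoined on a resolution of
   R/J. *)
- exists LJ; apply: Tor_len_sym; rewrite -xk.
  exact: Tor_len_sub Ix wx (subset_gen IJ Ix) hLJ.
- have sI := submodp_mem I; have sJ := submodp_mem J.
  have [_ [L [_ _ hLI]]] := flen_split sJ sI submodp_all (fun v => JI v) (fun _ _ => Logic.I) hLJ.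
  have h := Tor_len_sub Jy wy (subset_gen JI Jy) hLI; rewrite yn in h.
  (* So far the binomials have [n] in place of [k]. If k < n, Tor_n(R/J,R/I) vanishes because [I] is
     generated by a regular sequence of length k; then R/I has length 0, although [I] is proper. *)
  move: hkn; rewrite leq_eqVlt => /orP[/eqP ->|]; first by exists L.
  rewrite -xk => /(Tor_len_vanish Ix wx (Tor_len_sym h)) L0.
  case: x1; have := hLI; rewrite L0 => /(flen0_sub sI) /(_ 1 Logic.I).
  by rewrite Ix => /ideal_genE.
- rewrite k2 in xk *; case: x xk rx Ix wx x1 => [|a [|b [|]]]// _ _ Ix wx _.
  have [L h] := Tor_len2 hR hn Jy yn ry Ix wx.
  by exists L; exact: Tor_len_sym.
- have [wf f1] := regular_seq_ring rf; have [wI _] := regular_seq_qmod rI.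
  have kf : (k <= n)%N by lia.
  have [L hL] : exists L, flen (idl (fun r => r \in I) (drop k f)) allsm L.
    by apply: (regular_cat_len hR hn Ix rx rI); rewrite size_drop; lia.
  exists L; apply: (coefres_Tor_len (genJ _ Jf (drop k f ++ take k f) _)).
    by move=> z; rewrite mem_cat orbC -mem_cat cat_take_drop.
  have wc : wreg zerosm (drop k f ++ take k f).
    apply: (wreg_catC noethR locR) => //; last by rewrite cat_take_drop.
    by move=> z /mem_take; exact: proper_gen_local.
  have := @coefres_kill R I (drop k f) (take k f) 0 L wc (gen_in _ fI).
  rewrite size_takel ?fn// add0n; apply.
  by apply: coefres_bin0 => //; move: wc => /wreg_cat[].
- have [wf f1] := regular_seq_ring rf; have [wI _] := regular_seq_qmod rI.
  have kf : (k <= n)%N by lia.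
  have [L hL] : exists L, flen (idl (fun r => r \in I) (drop k f)) allsm L.
    by apply: (regular_cat_len hR hn Ix rx rI); rewrite size_drop; lia.
  (* Indices start at 0, so [v] is f_k, the generator covered neither by regularity on R/I nor by
     membership in [I]. *)
  pose v := f`_k.-1.
  have fE : f = take k.-1 f ++ v :: drop k f.
    rewrite -{1}(cat_take_drop k.-1 f) (drop_nth 0) ?fn; last by lia.
    by rewrite prednK//; lia.
  have fm := proper_gen_local hR f1.
  have vf : v \in f by rewrite fE mem_cat inE eqxx orbT.
  (* Two rotations: f_1, ..., f_k pass behind the rest, and then f_1, ..., f_(k-1) pass behind
     f_k. *)
  have wc : wreg zerosm (drop k f ++ v :: take k.-1 f).
    have : wreg zerosm (drop k f ++ (take k.-1 f ++ [:: v])).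
      apply: (wreg_catC noethR locR) => //; last by rewrite -catA -fE.
      by move=> z; rewrite mem_cat inE => /orP[/mem_take/fm//|/eqP ->]; exact: fm.
    move=> /wreg_cat[wd wt]; apply/wreg_cat; split=> //.
    apply: (wreg_catC noethR locR (t := [:: v])) wt; first exact: submodp_idl.
    by move=> z /mem_take; exact: fm.
  rewrite -cat_rcons in wc.
  have wr : wreg zerosm (rcons (drop k f) v) by move: wc => /wreg_cat[].
  have [e he] := coefres_bin1 wr wI hL.
  exists e; apply: (coefres_Tor_len (genJ _ Jf (rcons (drop k f) v ++ take k.-1 f) _)).
    move=> z; rewrite [in LHS]fE cat_rcons !mem_cat !inE.
    by case: (z \in drop k f); case: (z == v); case: (z \in take k.-1 f).
  have := @coefres_kill R I _ (take k.-1 f) 1 e wc (gen_in _ fI) he.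
  by rewrite size_takel ?fn ?add1n ?prednK//; lia.
Qed.
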